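(* Let $\mathcal H$ be a Hilbert space and let $A,B$ be bounded linear operators on $\mathcal H$ such that $0<m\le A,B\le M$ for scalars $m,M$. Let $0\le t\le 1$. Then \[A\natural_t B\le \eta(m,M,t)\,A\sharp_t B\le \Gamma(m,M,t)\,A\sharp_t B,\] where \[\eta(m,M,t):=\frac{1}{K^2\left(\sqrt{\frac{m}{M}},\sqrt{\frac{M}{m}},t\right)}\left(\frac{(M+m)^2}{4Mm}\right)^{1+t},\qquad \Gamma(m,M,t):=\frac{1}{K\left(\frac{m}{M},\frac{M}{m},t\right)}\,\frac{\left(M^{1+t}+m^{1+t}\right)^2}{4M^{1+t}m^{1+t}}.\]
   Context: For real scalars, $m\le A\le M$ means $mI\le A\le MI$ in the usual order on self-adjoint operators ($A\ge B$ iff $A-B$ is positive semi-definite); ''$m\le A,B\le M$'' means this holds for both $A$ and $B$. For positive definite $A,B$ and $0\le t\le 1$, the weighted geometric mean is $A\sharp_t B=A^{1/2}(A^{-1/2}BA^{-1/2})^{t}A^{1/2}$, $A\sharp B=A\sharp_{1/2}B$, and the weighted spectral geometric mean is $A\natural_t B=(A^{-1}\sharp B)^{t}A(A^{-1}\sharp B)^{t}$. The generalized Kantorovich constant is, for $0<a<b$ and $t\in\mathbb R$, \[K(a,b,t)=\frac{ab^t-ba^t}{(t-1)(b-a)}\left(\frac{t-1}{t}\,\frac{b^t-a^t}{ab^t-ba^t}\right)^t,\] with the value $1$ (the limiting value) when $t\in\{0,1\}$ or $a=b$. $K^2(\cdot)$ denotes the square of $K(\cdot)$. *)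

(* Defs.v *)
From HB Require Import structures.
From mathcomp Require Import all_boot all_order all_algebra.
From mathcomp Require Import all_classical all_reals all_analysis.
From mathcomp Require Import complex.
Import Order.TTheory GRing.Theory Num.Theory.
Import numFieldNormedType.Exports.

Set Implicit Arguments.
Unset Strict Implicit.
Unset Printing Implicit Defensive.

Local Open Scope classical_set_scope.
Local Open Scope ring_scope.
Local Open Scope complex_scope.

(* A complex Hilbert space is a Banach space H over R[i] whose norm comes from
   an inner product, linear in its first argument and conjugate-linear in its
   second. *)
Definition hilbert_inner (R : realType) (H : completeNormedModType R[i])
    (dot : {dot H for (@Num.conj R[i])}) : Prop :=
  forall x : H, dot x x = `|x| ^+ 2.

Section Operators.
Variables (R : realType) (H : completeNormedModType R[i]).
Variable dot : {dot H for (@Num.conj R[i])}.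
Implicit Types (S T X A B : H -> H) (s t a b m M : R).

Definition bounded_operator T : Prop :=
  linear T /\ exists c : R, forall x, `|T x| <= c%:C * `|x|.

Definition selfadjoint T : Prop := forall x y, dot (T x) y = dot x (T y).

(* In R[i], [0 <= z] means that z is real and nonnegative. *)
Definition psd T : Prop := selfadjoint T /\ forall x, 0 <= dot (T x) x.

Definition op_le S T : Prop := psd (T - S).

Definition scale_op s T : H -> H := fun x => s%:C *: T x.

Definition op_bounds m M T : Prop :=
  op_le (scale_op m idfun) T /\ op_le T (scale_op M idfun).

Definition op_inv T : H -> H :=
  xget 0 [set X | [/\ bounded_operator X, T \o X = idfun & X \o T = idfun]].

Definition op_horner (p : {poly R}) T : H -> H :=
  fun x => \sum_(i < size p) (p`_i)%:C *: iter i T x.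

(* Continuous functional calculus X = f(T) of a self-adjoint T with
   a <= T <= b, so that the spectrum of T lies in [a, b]: X is the limit in
   operator norm of polynomials p(T), where p tends to f uniformly
   on [a, b]. *)
Definition fun_calculus a b (f : R -> R) T X : Prop :=
  bounded_operator X /\
  forall e : R, 0 < e -> exists p : {poly R},
    (forall u : R, a <= u <= b -> `|p.[u] - f u| <= e) /\
    (forall x : H, `|op_horner p T x - X x| <= e%:C * `|x|).

(* T^s for a positive definite operator T (0 < a <= T <= b for some a and b);
   the result does not depend on the choice of a and b. *)
Definition op_pow T s : H -> H :=
  xget 0 [set X | exists a b : R,
    [/\ 0 < a, op_bounds a b T & fun_calculus a b (fun u => u `^ s) T X]].

Definition geomean t A B : H -> H :=
  op_pow A 2^-1 \o
  op_pow (op_pow A (- 2^-1) \o B \o op_pow A (- 2^-1)) t \o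
  op_pow A 2^-1.

Definition spectral_geomean t A B : H -> H :=
  let G := geomean 2^-1 (op_inv A) B in op_pow G t \o A \o op_pow G t.

End Operators.

Section Constants.
Variable R : realType.
Implicit Types a b t m M : R.

Definition kantorovich a b t : R :=
  if [|| t == 0, t == 1 | a == b] then 1 else
  (a * b `^ t - b * a `^ t) / ((t - 1) * (b - a)) *
  ((t - 1) / t * ((b `^ t - a `^ t) / (a * b `^ t - b * a `^ t))) `^ t.

Definition eta_const m M t : R :=
  1 / kantorovich (Num.sqrt (m / M)) (Num.sqrt (M / m)) t ^+ 2 *
  ((M + m) ^+ 2 / (4 * M * m)) `^ (1 + t).

Definition Gamma_const m M t : R :=
  1 / kantorovich (m / M) (M / m) t *
  ((M `^ (1 + t) + m `^ (1 + t)) ^+ 2 / (4 * M `^ (1 + t) * m `^ (1 + t))).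

End Constants.

(* Main.v *)
(* Put h = M / m, kappa = (M + m)^2 / (4 M m), G = A^-1 # B and let P be the
   square root of A^-1, so that G = P Q P with Q^2 = P^-1 B P^-1.

   For y = P^-1 x, the operator N = P^-1 G^t P^-1 lies between m and M, because
   u^t <= 1 - t + t u and u^-t <= 1 - t + t u^-1 bound N and N^-1 by weighted
   arithmetic means of A, Q and of their inverses.  Kantorovich's inequality for
   N, then <G^t y, y> <= |y|^(2(1-t)) <G y, y>^t and Cauchy-Schwarz give
     <(A nat_t B) y, y> <= kappa <A y, y>^(1-t) <B y, y>^t.
   The chord of u^t over [m/M, M/m] gives
     K(m/M, M/m, t) <A y, y>^(1-t) <B y, y>^t <= <(A #_t B) y, y>.
   It remains to compare kappa / K(m/M, M/m, t) with eta and eta with Gamma.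
   With h = e^(2s), K(sqrt(m/M), sqrt(M/m), t)^2 / K(m/M, M/m, t) equals
     (tanh((1-t)s) / ((1-t) tanh s))^(1-t) (tanh(ts) / (t tanh s))^t,
   which is at least 1 by concavity of tanh, and at most kappa^t by the weighted
   AM-GM inequality and the addition formula for tanh.

   Positivity of p(T) for a polynomial p >= 0 on [a, b] and a <= T <= b needs no
   spectral theory: subtract from p its minimum on [a, b], divide by the
   resulting factor X - a, b - X or (X - c)^2, and induct on the degree. *)

Require Import Defs.
From HB Require Import structures.
From mathcomp Require Import all_boot all_order all_algebra.
From mathcomp Require Import all_classical all_reals all_analysis.
From mathcomp Require Import complex.
From mathcomp Require Import ring lra.
Import Order.TTheory GRing.Theory Num.Theory.
Import numFieldNormedType.Exports.

Set Implicit Arguments.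
Unset Strict Implicit.
Unset Printing Implicit Defensive.

Local Open Scope ring_scope.

(** * Real powers and the Kantorovich constants *)

Lemma powR_inv (R : realType) (s x : R) : 0 <= x -> x^-1 `^ s = (x `^ s)^-1.
Proof.
by move=> x0; rewrite -powR_inv1// -powRrM mulrC powRrM powR_inv1// powR_ge0.
Qed.

Lemma powR_expn (R : realType) (s x : R) n : 0 <= x -> (x ^+ n) `^ s = (x `^ s) ^+ n.
Proof.
by move=> x0; rewrite -(powR_mulrn n x0) -powRrM mulrC powRrM (powR_mulrn n (powR_ge0 x s)).
Qed.

Lemma ln_le_sub1 (R : realType) (x : R) : 0 < x -> ln x <= x - 1.
Proof.
move=> x0; have := expR_ge1Dx (ln x); rewrite lnK ?posrE//; lra.
Qed.

Lemma powR_young (R : realType) (t x y : R) : 0 <= t <= 1 -> 0 < x -> 0 < y ->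
  x `^ (1 - t) * y `^ t <= (1 - t) * x + t * y.
Proof.
move=> /andP[t0 t1] x0 y0.
have t1' : 0 <= 1 - t by rewrite subr_ge0.
pose s := (1 - t) * x + t * y; rewrite -/s.
have s0 : 0 < s by rewrite /s; nra.
have hx := ln_le_sub1 (divr_gt0 x0 s0).
have hy := ln_le_sub1 (divr_gt0 y0 s0).
rewrite -ler_ln ?posrE ?mulr_gt0 ?powR_gt0//.
rewrite lnM ?posrE ?powR_gt0// !ln_powR.
rewrite !ln_div ?posrE// in hx hy.
have h1 := ler_wpM2l t1' hx.
have h2 := ler_wpM2l t0 hy.
have h3 : (1 - t) * (x / s - 1) + t * (y / s - 1) = 0.
  have -> : (1 - t) * (x / s - 1) + t * (y / s - 1) = s / s - 1 by rewrite {3}/s; ring.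
  by rewrite divff ?subrr// gt_eqF.
lra.
Qed.

Lemma powR_tangent (R : realType) (t l u : R) : 0 <= t <= 1 -> 0 < l -> 0 < u ->
  u `^ t <= (1 - t) * l `^ t + t * l `^ (t - 1) * u.
Proof.
move=> ht l0 u0; have := powR_young ht l0 u0.
rewrite !powRB ?(gt_eqF l0) ?implybT// powRr1 ?(ltW l0)//.
have := powR_gt0 t l0; set lt := l `^ t; set ut := u `^ t => lt0 h.
have -> : (1 - t) * lt + t * (lt / l) * u = (lt / l) * ((1 - t) * l + t * u).
  by field; rewrite gt_eqF.
have {1}-> : ut = (lt / l) * (l / lt * ut) by field; rewrite !gt_eqF.
by apply: ler_wpM2l h; rewrite divr_ge0// ltW.
Qed.

Lemma powRN_bernoulli (R : realType) (t u : R) : 0 <= t <= 1 -> 0 < u ->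
  u `^ (- t) <= (1 - t) + t * u `^ (- 1).
Proof.
move=> ht u0; rewrite powRN -(powR_inv _ (ltW u0)) powR_inv1 ?(ltW u0)//.
have ui0 : 0 < u^-1 by rewrite invr_gt0.
by have := powR_young ht ltr01 ui0; rewrite powR1 mul1r mulr1.
Qed.

(* In terms of [u = e^(2s)]: [t tanh s <= tanh (ts)]. *)
Lemma powR_sub1_ge (R : realType) (t u : R) : 0 <= t <= 1 -> 1 <= u ->
  t * (u - 1) * (u `^ t + 1) <= (u `^ t - 1) * (u + 1).
Proof.
move=> ht u1; have /andP[t0 t1] := ht.
pose F (v : R) := (1 - t) * v `^ (t + 1) + (1 + t) * (v `^ t - v).
pose dF (v : R) := (1 + t) * ((1 - t) * v `^ t + t * v `^ (t - 1) - 1).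
have dF_F (x : R) : 0 < x -> is_derive x 1 F (dF x).
  move=> x0; rewrite /F.
  have d1 := is_derive1_powR (t + 1) x0.
  have d2 := is_derive1_powR t x0.
  apply: is_derive_eq.
  by rewrite /GRing.scale /= /dF addrK; ring.
have cF : {within `[1, u], continuous F}%classic.
  apply: derivable_within_continuous => x; rewrite in_itv/= => /andP[x1 _].
  by have [] := dF_F x (lt_le_trans ltr01 x1).
have dFge (x : R) : 1 <= x -> 0 <= dF x.
  move=> x1; have x0 := lt_le_trans ltr01 x1.
  have := powR_young ht (powR_gt0 t x0) (powR_gt0 (t - 1) x0).
  rewrite -!powRrM -powRD ?(gt_eqF x0) ?implybT//.
  have -> : t * (1 - t) + (t - 1) * t = 0 by ring.
  rewrite powRr0 /dF => h; apply: mulr_ge0; lra.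
have : F 1 <= F u.
  move: (u1); rewrite le_eqVlt => /predU1P[<-//|u1'].
  have [x||c] := @MVT R F dF 1 u u1'.
  - by rewrite in_itv/= => /andP[x1 _]; apply/dF_F/(lt_trans _ x1).
  - exact: cF.
  rewrite in_itv/= => /andP[c1 _] h; rewrite -subr_ge0 h mulr_ge0 ?subr_ge0//.
  by apply: dFge; exact: ltW.
have u0 : 0 < u by exact: lt_le_trans u1.
rewrite /F !powR1 powRD ?(gt_eqF u0) ?implybT// powRr1 ?(ltW u0)//.
by set v := u `^ t; nra.
Qed.

Lemma powR_lt_mono (R : realType) (t a b : R) : 0 < t -> 0 < a -> a < b -> a `^ t < b `^ t.
Proof.
by move=> t0 a0 ab; apply: gt0_ltr_powR; rewrite // ?nnegrE ltW// (lt_trans a0).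
Qed.

Lemma powR_chord_gt0 (R : realType) (t a b : R) : 0 < t < 1 -> 0 < a -> a < b ->
  0 < b * a `^ t - a * b `^ t.
Proof.
move=> /andP[t0 t1] a0 ab; have b0 := lt_trans a0 ab.
have h : a `^ (1 - t) < b `^ (1 - t) by apply: powR_lt_mono; rewrite ?subr_gt0.
rewrite !powRB ?(gt_eqF a0) ?(gt_eqF b0) ?implybT// !powRr1 ?(ltW a0) ?(ltW b0)// in h.
by rewrite ltr_pdivrMr ?powR_gt0// mulrAC ltr_pdivlMr ?powR_gt0// in h; rewrite subr_gt0.
Qed.

Lemma kantorovichE (R : realType) (t a b : R) : 0 < t < 1 -> 0 < a -> a < b ->
  kantorovich a b t = ((b * a `^ t - a * b `^ t) / ((1 - t) * (b - a))) `^ (1 - t) *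
    ((b `^ t - a `^ t) / (t * (b - a))) `^ t.
Proof.
move=> ht a0 ab; have /andP[t0 t1] := ht.
have al := powR_chord_gt0 ht a0 ab.
have t1' : 0 < 1 - t by rewrite subr_gt0.
have ab' : 0 < b - a by rewrite subr_gt0.
have be : 0 < b `^ t - a `^ t by rewrite subr_gt0 powR_lt_mono.
rewrite /kantorovich (gt_eqF t0) (lt_eqF t1) (lt_eqF ab) /=.
set c := b * _ - _ in al *; set d := _ - _ in be *.
have x0 : 0 < c / ((1 - t) * (b - a)) by rewrite divr_gt0// mulr_gt0.
rewrite powRB ?(gt_eqF x0) ?implybT// powRr1 ?(ltW x0)//.
have -> : a * b `^ t - b * a `^ t = - c by rewrite /c; ring.
clearbody c d.
rewrite -[RHS]mulrA; congr (_ * _).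
  by field; rewrite !subr_eq0 (lt_eqF t1) (gt_eqF t1) (gt_eqF ab).
have xt0 : 0 < (c / ((1 - t) * (b - a))) `^ t by rewrite powR_gt0.
apply: (mulfI (lt0r_neq0 xt0)).
have e : (t - 1) / t * (d / - c) = (1 - t) / t * (d / c).
  by field; rewrite (gt_eqF t0) (gt_eqF al).
rewrite mulVKf ?gt_eqF// e -powRM ?(ltW x0)//.
  congr (_ `^ _); field.
  by rewrite !subr_eq0 (gt_eqF t0) (gt_eqF t1) (gt_eqF ab) (gt_eqF al).
by rewrite ltW// mulr_gt0// divr_gt0.
Qed.

Lemma kantorovich_gt0 (R : realType) (t a b : R) : 0 <= t <= 1 -> 0 < a -> a <= b ->
  0 < kantorovich a b t.
Proof.
move=> /andP[t0 t1] a0 ab; have [tt|] := boolP [|| t == 0, t == 1 | a == b].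
  by rewrite /kantorovich tt.
rewrite !negb_or => /and3P[tn0 tn1 abn].
have ht : 0 < t < 1 by rewrite !lt_neqAle t0 t1 tn1 eq_sym tn0.
have {}ab : a < b by rewrite lt_neqAle abn.
have /andP[{}t0 {}t1] := ht.
rewrite kantorovichE// mulr_gt0 ?powR_gt0// divr_gt0 ?mulr_gt0 ?subr_gt0//.
  by rewrite -subr_gt0 powR_chord_gt0.
exact: powR_lt_mono.
Qed.

(* The coefficients are those of the chord of [u `^ t] over [a, b]; minimizing
   the ratio of the chord to [u `^ t] over all [u > 0] gives the constant. *)
Lemma powR_ge_chord (R : realType) (t a b : R) : 0 <= t <= 1 -> 0 < a -> a <= b ->
  exists c d : R, [/\ 0 <= c, 0 <= d, forall u, a <= u <= b -> c + d * u <= u `^ t &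
    forall p q, 0 < p -> 0 < q ->
      kantorovich a b t * (p `^ (1 - t) * q `^ t) <= c * p + d * q].
Proof.
move=> ht a0 ab; have b0 := lt_le_trans a0 ab.
have /andP[t0 t1] := ht.
have [->|tn0] := eqVneq t 0.
  exists 1, 0; split=> // [u _|p q p0 q0]; first by rewrite powRr0 mul0r addr0.
  by rewrite /kantorovich eqxx /= subr0 powRr0 powRr1 ?(ltW p0)// mul0r addr0 mulr1.
have [->|tn1] := eqVneq t 1.
  exists 0, 1; split=> // [u /andP[u1 _]|p q p0 q0].
    by rewrite powRr1 ?mul1r ?add0r// (le_trans _ u1)// ltW.
  by rewrite /kantorovich eqxx orbT /= subrr powRr0 powRr1 ?(ltW q0)// mul0r add0r mul1r.
have ht' : 0 < t < 1 by rewrite !lt_neqAle t0 t1 tn1 eq_sym tn0.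
have /andP[{}t0 {}t1] := ht'.
move: ab; rewrite le_eqVlt => /predU1P[ab|ab].
  rewrite -ab; exists ((1 - t) * a `^ t), (t * a `^ (t - 1)).
  split=> [||u|p q p0 q0]; rewrite ?mulr_ge0 ?powR_ge0 ?subr_ge0 ?(ltW t0) ?(ltW t1)//.
    rewrite -eq_le => /eqP <-.
    rewrite powRB ?(gt_eqF a0) ?implybT// powRr1 ?(ltW a0)//.
    have -> // : (1 - t) * a `^ t + t * (a `^ t / a) * a = a `^ t.
    by field; rewrite gt_eqF.
  rewrite /kantorovich eqxx !orbT mul1r.
  have h := powR_young ht (mulr_gt0 (powR_gt0 t a0) p0)
    (mulr_gt0 (powR_gt0 (t - 1) a0) q0).
  rewrite !powRM ?powR_ge0 ?(ltW p0) ?(ltW q0)// -!powRrM in h.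
  rewrite mulrACA -powRD ?(gt_eqF a0) ?implybT// in h.
  have e : t * (1 - t) + (t - 1) * t = 0 by ring.
  by rewrite e powRr0 mul1r !mulrA in h.
have ab' : 0 < b - a by rewrite subr_gt0.
have al := powR_chord_gt0 ht' a0 ab.
have be : 0 < b `^ t - a `^ t by rewrite subr_gt0 powR_lt_mono.
exists ((b * a `^ t - a * b `^ t) / (b - a)), ((b `^ t - a `^ t) / (b - a)).
split=> [||u /andP[au ub]|p q p0 q0]; rewrite ?divr_ge0 ?(ltW al) ?(ltW be) ?(ltW ab')//.
  have u0 := lt_le_trans a0 au.
  have ha := powR_tangent ht u0 a0.
  have hb := powR_tangent ht u0 b0.
  have {}ha := ler_wpM2l (_ : 0 <= b - u) ha; rewrite subr_ge0 in ha.
  have {}hb := ler_wpM2l (_ : 0 <= u - a) hb; rewrite subr_ge0 in hb.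
  have {ha hb} := lerD (ha ub) (hb au).
  have e : u `^ t = u `^ (t - 1) * u.
    rewrite -[X in _ * X]powRr1 ?(ltW u0)// -powRD ?(gt_eqF u0) ?implybT//.
    by congr (_ `^ _); ring.
  rewrite [_ / _ * u]mulrAC -mulrDl ler_pdivrMr// => h.
  by apply: le_trans (le_trans h _); rewrite ?e le_eqVlt; apply/orP; left; apply/eqP; ring.
rewrite kantorovichE//.
have t1' : 0 < 1 - t by rewrite subr_gt0.
set x := _ / ((1 - t) * _); set y := _ / (t * _).
have x0 : 0 < x by rewrite divr_gt0// mulr_gt0.
have y0 : 0 < y by rewrite divr_gt0// mulr_gt0.
have h := powR_young ht (mulr_gt0 x0 p0) (mulr_gt0 y0 q0).
rewrite (powRM _ (ltW x0) (ltW p0)) (powRM _ (ltW y0) (ltW q0)) in h.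
rewrite mulrACA; apply: (le_trans h); rewrite le_eqVlt; apply/orP; left; apply/eqP.
rewrite /x /y; field.
by rewrite !subr_eq0 (gt_eqF t0) (gt_eqF t1) (gt_eqF ab).
Qed.

Lemma kantorovich_symE (R : realType) (t b : R) : 0 < t < 1 -> 1 < b ->
  let p := b `^ t in
  kantorovich b^-1 b t =
    ((b ^+ 2 - p ^+ 2) / (p * (1 - t) * (b ^+ 2 - 1))) `^ (1 - t) *
    (b * (p ^+ 2 - 1) / (p * t * (b ^+ 2 - 1))) `^ t.
Proof.
move=> ht b1 p; have /andP[t0 t1] := ht; have b0 : 0 < b := lt_trans ltr01 b1.
have p0 : 0 < p by rewrite powR_gt0.
have bi1 : b^-1 < b by rewrite (lt_trans _ b1)// invf_lt1.
have b2 : b ^+ 2 - 1 != 0 by rewrite subr_eq0 gt_eqF// expr_gt1// ltW.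
rewrite kantorovichE ?invr_gt0//.
have -> : b^-1 `^ t = p^-1.
  by rewrite powR_inv// ltW.
rewrite -/p; congr (_ `^ _ * _ `^ _); field.
  by rewrite b2 subr_eq0 (gt_eqF t1) (gt_eqF b0) (gt_eqF p0).
by rewrite (gt_eqF t0) (gt_eqF b0) (gt_eqF p0) b2.
Qed.

Lemma kantorovich_sqr_bounds (R : realType) (t b : R) : 0 < t < 1 -> 1 < b ->
  kantorovich (b ^+ 2)^-1 (b ^+ 2) t <= kantorovich b^-1 b t ^+ 2 <=
  ((b ^+ 2 + 1) ^+ 2 / (4 * b ^+ 2)) `^ t * kantorovich (b ^+ 2)^-1 (b ^+ 2) t.
Proof.
move=> ht b1; have /andP[t0 t1] := ht; have b0 : 0 < b := lt_trans ltr01 b1.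
have htW : 0 <= t <= 1 by rewrite !ltW.
have r0 : 0 < 1 - t by rewrite subr_gt0.
have rW : 0 <= 1 - t <= 1 by lra.
have B1 : 1 < b ^+ 2 by rewrite expr_gt1// ltW.
rewrite !kantorovich_symE//; cbv zeta.
have e := powR_expn t 2 (ltW b0).
rewrite e.
have c1 := powR_sub1_ge htW (ltW B1).
have c2 := powR_sub1_ge rW (ltW B1).
have Bn0 : b ^+ 2 != 0 by rewrite gt_eqF// (lt_trans _ B1).
rewrite powRB ?Bn0 ?implybT// powRr1 ?sqr_ge0// in c2.
have P1 : 1 < b `^ t by have := powR_lt_mono t0 ltr01 b1; rewrite powR1.
have P2 : b `^ t < b.
  have : 1 < b `^ (1 - t) by have := powR_lt_mono r0 ltr01 b1; rewrite powR1.
  by rewrite powRB ?(gt_eqF b0) ?implybT// powRr1 ?(ltW b0)// ltr_pdivlMr ?mul1r// powR_gt0.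
rewrite e in c1 c2.
set p := b `^ t in P1 P2 c1 c2 e *.
have p0 : 0 < p by exact: lt_trans P1.
have PP1 : 1 < p ^+ 2 by rewrite expr_gt1// ltW.
have PB : p ^+ 2 < b ^+ 2 by rewrite ltr_pXn2r// nnegrE ltW.
clearbody p.
set B := b ^+ 2 in c1 c2 B1 Bn0 PB *; set P := p ^+ 2 in c1 c2 PP1 PB *.
have B0 : 0 < B by exact: lt_trans B1.
have P0 : 0 < P by exact: lt_trans PP1.
pose x := (B - P) * (B + 1) / ((1 - t) * (B - 1) * (B + P)).
pose y := (P - 1) * (B + 1) / (t * (B - 1) * (P + 1)).
pose k := (B + 1) ^+ 2 / (4 * B).
have k0 : 0 < k by rewrite divr_gt0 ?exprn_gt0 ?mulr_gt0 ?addr_gt0.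
have b20 : 0 < B - 1 by rewrite subr_gt0.
have bP0 : 0 < B - P by rewrite subr_gt0.
have P10 : 0 < P - 1 by rewrite subr_gt0.
have b21 : 0 < B ^+ 2 - 1 by rewrite subr_gt0 expr_gt1// ltW.
have p21 : 0 < P ^+ 2 - 1 by rewrite subr_gt0 expr_gt1// ltW.
have bP2 : 0 < B ^+ 2 - P ^+ 2 by rewrite subr_gt0 ltr_pXn2r// nnegrE ltW.
set X2 := _ / _; set Y2 := _ / _; set X1 := _ / _; set Y1 := _ / _.
have X10 : 0 < X1 by rewrite /X1 divr_gt0 ?mulr_gt0 // ?mulr_gt0.
have Y10 : 0 < Y1 by rewrite /Y1 divr_gt0 ?mulr_gt0 // ?mulr_gt0.
have X20 : 0 < X2 by rewrite /X2 divr_gt0 ?mulr_gt0 // ?mulr_gt0.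
have Y20 : 0 < Y2 by rewrite /Y2 divr_gt0 ?mulr_gt0 // ?mulr_gt0.
have x0 : 0 < x by rewrite /x divr_gt0 ?mulr_gt0 // ?mulr_gt0 // ?addr_gt0.
have y0 : 0 < y by rewrite /y divr_gt0 ?mulr_gt0 // ?mulr_gt0 // ?addr_gt0.
have nz : [/\ B - 1 != 0, B + 1 != 0, B + P != 0, P + 1 != 0 & B ^+ 2 - 1 != 0].
  by split; rewrite gt_eqF // addr_gt0.
have [nz1 nz2 nz3 nz4 nz5] := nz.
have xE : X1 ^+ 2 = X2 * x.
  rewrite /X1 /X2 /x /P; field.
  by rewrite nz1 nz3 nz5 (gt_eqF p0) (gt_eqF r0).
have yE : Y1 ^+ 2 = Y2 * y.
  rewrite /Y1 /Y2 /y /P /B; field.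
  by rewrite nz1 nz4 nz5 (gt_eqF p0) (gt_eqF t0).
have x1 : 1 <= x.
  rewrite /x ler_pdivlMr ?mul1r; last by rewrite !mulr_gt0 // addr_gt0.
  have := ler_wpM2r (ltW P0) c2.
  have -> : (1 - t) * (B - 1) * (B / P + 1) * P = (1 - t) * (B - 1) * (B + P).
    by field; rewrite gt_eqF.
  have -> // : (B / P - 1) * (B + 1) * P = (B - P) * (B + 1).
  by field; rewrite gt_eqF.
have y1 : 1 <= y by rewrite /y ler_pdivlMr ?mul1r// !mulr_gt0 // addr_gt0.
have kxy : (1 - t) * x + t * (y / k) <= 1.
  rewrite -subr_ge0.
  have -> : 1 - ((1 - t) * x + t * (y / k)) =
      2 * B * (P - 1) ^+ 2 / ((B + 1) * (B + P) * (P + 1)).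
    rewrite /x /y /k; field.
    by rewrite (gt_eqF B0) (gt_eqF r0) (gt_eqF t0) nz1 nz2 nz3 nz4.
  by rewrite ltW// divr_gt0 ?mulr_gt0 // ?mulr_gt0 // ?exprn_gt0 // addr_gt0.
have KE : (X1 `^ (1 - t) * Y1 `^ t) ^+ 2 =
    (X2 `^ (1 - t) * Y2 `^ t) * (x `^ (1 - t) * y `^ t).
  rewrite mulrACA -(powRM _ (ltW X20) (ltW x0)) -(powRM _ (ltW Y20) (ltW y0)).
  by rewrite -xE -yE exprMn (powR_expn _ 2 (ltW X10)) (powR_expn _ 2 (ltW Y10)).
have K20 : 0 < X2 `^ (1 - t) * Y2 `^ t by rewrite mulr_gt0 ?powR_gt0.
rewrite KE; apply/andP; split.
  rewrite ler_peMr ?(ltW K20)//.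
  have h1 : 1 <= x `^ (1 - t).
    by have := ge0_ler_powR (ltW r0) _ _ x1; rewrite powR1; apply; rewrite nnegrE ltW.
  have h2 : 1 <= y `^ t.
    by have := ge0_ler_powR (ltW t0) _ _ y1; rewrite powR1; apply; rewrite nnegrE ltW.
  exact: mulr_ege1.
rewrite mulrC ler_pM2r//.
have := powR_young htW x0 (divr_gt0 y0 k0).
move=> /le_trans/(_ kxy); have {2}-> : y = (y / k) * k by rewrite divfK ?gt_eqF.
move=> h; rewrite (powRM _ (ltW (divr_gt0 y0 k0)) (ltW k0)) mulrA.
by rewrite ler_piMl ?powR_ge0.
Qed.

Lemma powR_midpoint_le (R : realType) (s x y : R) : 1 <= s -> 0 <= x -> 0 <= y ->
  ((x + y) / 2) `^ s <= (x `^ s + y `^ s) / 2.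
Proof.
move=> s1 x0 y0.
rewrite mulrDl (mulrC x) (mulrC y) mulrDl (mulrC (x `^ s)) (mulrC (y `^ s)).
rewrite {2 4}(_ : 2^-1 = 1 - 2^-1); last by lra.
apply: (convex_powR s1 (Itv01 _ _)) => //=;
  rewrite ?inE/= ?in_itv/= ?x0 ?y0// ?invr_ge0// invf_le1 ?ler1n//.
Qed.

Lemma kantorovich_ratio_bounds (R : realType) (m M t : R) : 0 < m -> m <= M -> 0 <= t <= 1 ->
  kantorovich (m / M) (M / m) t <=
    kantorovich (Num.sqrt (m / M)) (Num.sqrt (M / m)) t ^+ 2 <=
  ((M + m) ^+ 2 / (4 * M * m)) `^ t * kantorovich (m / M) (M / m) t.
Proof.
move=> m0 mM ht; have M0 := lt_le_trans m0 mM; have /andP[t0 t1] := ht.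
have k1 : 1 <= (M + m) ^+ 2 / (4 * M * m).
  rewrite ler_pdivlMr ?mulr_gt0// mul1r -subr_ge0.
  by rewrite (_ : _ - _ = (M - m) ^+ 2) ?sqr_ge0//; ring.
have [->|tn0] := eqVneq t 0.
  by rewrite /kantorovich eqxx /= powRr0 expr1n mul1r lexx.
have [->|tn1] := eqVneq t 1.
  by rewrite /kantorovich eqxx /= !orbT powRr1 ?(le_trans ler01 k1)// expr1n mulr1 lexx.
have ht' : 0 < t < 1 by rewrite !lt_neqAle t0 t1 tn1 eq_sym tn0.
move: mM; rewrite le_eqVlt => /predU1P[mM|mM].
  rewrite -mM /kantorovich !eqxx !orbT expr1n mulr1.
  have -> : (m + m) ^+ 2 / (4 * m * m) = 1 by field; rewrite gt_eqF.
  by rewrite powR1 lexx.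
have b1 : 1 < Num.sqrt (M / m).
  by rewrite -[X in X < _]sqrtr1 ltr_sqrt ?divr_gt0// ltr_pdivlMr ?mul1r.
have := kantorovich_sqr_bounds ht' b1.
have hMm : 0 <= M / m by rewrite divr_ge0// ltW.
rewrite (sqr_sqrtr hMm) -(sqrtrV hMm) invf_div.
have -> : (M / m + 1) ^+ 2 / (4 * (M / m)) = (M + m) ^+ 2 / (4 * M * m).
  by field; rewrite !gt_eqF.
exact.
Qed.

Lemma kantorovich_div_le_eta (R : realType) (m M t : R) : 0 < m -> m <= M -> 0 <= t <= 1 ->
  (M + m) ^+ 2 / (4 * M * m) / kantorovich (m / M) (M / m) t <= eta_const m M t.
Proof.
move=> m0 mM ht; have M0 := lt_le_trans m0 mM.
have /andP[_ h] := kantorovich_ratio_bounds m0 mM ht.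
have rr : m / M <= M / m.
  by rewrite ler_pdivrMr// mulrAC ler_pdivlMr// -!expr2 ler_pXn2r// nnegrE ltW.
have K2 : 0 < kantorovich (m / M) (M / m) t by apply: kantorovich_gt0; rewrite ?divr_gt0.
have K1 : 0 < kantorovich (Num.sqrt (m / M)) (Num.sqrt (M / m)) t.
  by apply: kantorovich_gt0; rewrite ?sqrtr_gt0 ?ler_sqrt ?divr_gt0 ?(ltW (divr_gt0 M0 m0)).
rewrite /eta_const; set k := (M + m) ^+ 2 / _ in h *.
have k0 : 0 < k by rewrite divr_gt0 ?mulr_gt0 ?exprn_gt0// addr_gt0.
rewrite powRD ?(gt_eqF k0) ?implybT// powRr1 ?(ltW k0)//.
clearbody k; move: h K1 K2 k0.
move: k (k `^ t) (kantorovich _ _ _) (kantorovich (m / M) _ _) => k l y x h y0 x0 k0.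
have -> : 1 / y ^+ 2 * (k * l) = (k / x) * ((l * x) / y ^+ 2).
  by field; rewrite !gt_eqF.
by apply: ler_peMr; rewrite ?(ltW (divr_gt0 k0 x0))// ler_pdivlMr ?exprn_gt0// mul1r.
Qed.

Lemma eta_le_Gamma (R : realType) (m M t : R) : 0 < m -> m <= M -> 0 <= t <= 1 ->
  eta_const m M t <= Gamma_const m M t.
Proof.
move=> m0 mM ht; have M0 := lt_le_trans m0 mM.
have /andP[h _] := kantorovich_ratio_bounds m0 mM ht.
have rr : m / M <= M / m.
  by rewrite ler_pdivrMr// mulrAC ler_pdivlMr// -!expr2 ler_pXn2r// nnegrE ltW.
have K2 : 0 < kantorovich (m / M) (M / m) t by apply: kantorovich_gt0; rewrite ?divr_gt0.
have K1 : 0 < kantorovich (Num.sqrt (m / M)) (Num.sqrt (M / m)) t.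
  by apply: kantorovich_gt0; rewrite ?sqrtr_gt0 ?ler_sqrt ?divr_gt0 ?(ltW (divr_gt0 M0 m0)).
rewrite /eta_const /Gamma_const.
move: h K1 K2; move: (kantorovich (Num.sqrt _) _ _) (kantorovich _ _ _) => y x h y0 x0.
apply: ler_pM.
- by apply: divr_ge0 => //; exact/exprn_ge0/ltW.
- exact: powR_ge0.
- by rewrite ler_pM2l// lef_pV2 ?posrE ?exprn_gt0.
have s1 : 1 <= 1 + t by case/andP: ht; lra.
have s0 : 0 <= 1 + t by lra.
have := powR_midpoint_le s1 (ltW M0) (ltW m0).
set Ms := M `^ _; set ms := m `^ _ => hs.
have Ms0 : 0 < Ms by rewrite powR_gt0.
have ms0 : 0 < ms by rewrite powR_gt0.
have -> : (M + m) ^+ 2 / (4 * M * m) = ((M + m) / 2) ^+ 2 / (M * m).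
  by field; rewrite !gt_eqF.
have Mm2 : 0 <= (M + m) / 2 by rewrite divr_ge0// addr_ge0// ltW.
have Mmi : 0 <= (M * m)^-1 by rewrite invr_ge0 mulr_ge0 ?ltW.
rewrite (powRM _ (exprn_ge0 2 Mm2) Mmi).
have -> : (M * m)^-1 `^ (1 + t) = (Ms * ms)^-1.
  by rewrite powR_inv ?(powRM _ (ltW M0) (ltW m0))// mulr_ge0// ltW.
have -> : (((M + m) / 2) ^+ 2) `^ (1 + t) = (((M + m) / 2) `^ (1 + t)) ^+ 2.
  exact: powR_expn.
have -> : (Ms + ms) ^+ 2 / (4 * Ms * ms) = ((Ms + ms) / 2) ^+ 2 / (Ms * ms).
  by field; rewrite !gt_eqF.
rewrite ler_pM2r ?invr_gt0 ?mulr_gt0// ler_pXn2r// nnegrE ?powR_ge0//.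
by rewrite divr_ge0// addr_ge0// ltW.
Qed.

(** * Polynomial approximation and positivity *)

(* [\sum_k g k * 'C(n, k) * X^k * (1 - X)^(n - k)], by Pascal's recursion. *)
Fixpoint bernstein (R : realType) (n : nat) (g : nat -> R) : {poly R} :=
  if n is n'.+1 then 'X * bernstein n' (g \o S) + (1 - 'X) * bernstein n' g
  else (g 0%N)%:P.

Lemma bernstein_le (R : realType) (x : R) (n : nat) (g h : nat -> R) : 0 <= x <= 1 ->
  (forall k, (k <= n)%N -> g k <= h k) -> (bernstein n g).[x] <= (bernstein n h).[x].
Proof.
move=> /andP[x0 x1]; elim: n g h => [|n IH] g h gh /=; rewrite !hornerE; first exact: gh.
rewrite lerD// ler_wpM2l// ?subr_ge0//; apply: IH => k kn; apply: gh => //.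
exact: ltnW.
Qed.

(* With [c = n x] this is the variance [n x (1 - x)] of the binomial law. *)
Lemma bernstein_sqr (R : realType) (x al be c : R) (n : nat) :
  (bernstein n (fun k => al + be * (k%:R - c) ^+ 2)).[x] =
  al + be * (n%:R * x * (1 - x) + (n%:R * x - c) ^+ 2).
Proof.
elim: n c => [|n IH] c /=; rewrite !hornerE; first by ring.
rewrite IH (_ : _ \o _ = fun k => al + be * (k%:R - (c - 1)) ^+ 2).
  by rewrite IH -natr1; ring.
by apply/funext => k /=; rewrite -natr1; congr (_ + _ * _ ^+ 2); ring.
Qed.

Lemma lipschitz_poly_approx01 (R : realType) (f : R -> R) (L e : R) : 0 <= L -> 0 < e ->
  (forall x y, 0 <= x <= 1 -> 0 <= y <= 1 -> `|f x - f y| <= L * `|x - y|) ->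
  exists p : {poly R}, forall x, 0 <= x <= 1 -> `|p.[x] - f x| <= e.
Proof.
move=> L0 e0 fL; pose d := e / (2 * (L + 1)).
have L1 : 0 < L + 1 by lra.
have d0 : 0 < d by rewrite divr_gt0 ?mulr_gt0.
pose n := (Num.truncn (2 * L / (d * e))).+1.
have n0 : 0 < n%:R :> R by rewrite ltr0n.
have nbig : 2 * L / (d * e) <= n%:R by rewrite ltW// truncnS_gt.
exists (bernstein n (fun k => f (k%:R / n%:R))) => x x01.
have /andP[x0 x1] := x01.
have key k : (k <= n)%N -> `|f (k%:R / n%:R) - f x| <=
    L * d + L / d / n%:R ^+ 2 * (k%:R - n%:R * x) ^+ 2.
  move=> kn; apply: le_trans (fL _ _ _ x01) _.
    by rewrite divr_ge0//= ler_pdivrMr// mul1r ler_nat.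
  set y := _ / _ - x.
  have -> : L / d / n%:R ^+ 2 * (k%:R - n%:R * x) ^+ 2 = L * (y ^+ 2 / d).
    by rewrite /y; field; rewrite !gt_eqF.
  rewrite -mulrDr; apply: ler_wpM2l => //.
  rewrite -(ler_pM2r d0) mulrDl divfK ?gt_eqF// -[y ^+ 2]real_normK ?num_real//.
  by have := normr_ge0 y; set z := `|y|; nra.
have small : L * d + L / d / n%:R ^+ 2 * (n%:R * x * (1 - x) + (n%:R * x - n%:R * x) ^+ 2) <= e.
  have h1 : L * d <= e / 2.
    rewrite /d mulrA ler_pdivrMr ?mulr_gt0//.
    have -> : e / 2 * (2 * (L + 1)) = L * e + e by field.
    by rewrite lerDl ltW.
  have h2 : L / d / n%:R ^+ 2 * (n%:R * x * (1 - x) + (n%:R * x - n%:R * x) ^+ 2) <= e / 2.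
    have -> : L / d / n%:R ^+ 2 * (n%:R * x * (1 - x) + (n%:R * x - n%:R * x) ^+ 2) =
        L / d / n%:R * (x * (1 - x)).
      by field; rewrite !gt_eqF.
    have le1 : x * (1 - x) <= 1 by nra.
    have c0 : 0 <= L / d / n%:R by apply: divr_ge0 => //; apply: divr_ge0 => //; exact: ltW.
    apply: (le_trans (ler_wpM2l c0 le1)); rewrite mulr1 ler_pdivrMr// ler_pdivrMr//.
    move: nbig; rewrite (ler_pdivrMr _ _ (mulr_gt0 d0 e0)) => nbig.
    lra.
  lra.
pose q c k := f x + (c * (L * d) + c * (L / d / n%:R ^+ 2) * (k%:R - n%:R * x) ^+ 2).
have shift c : (bernstein n (q c)).[x] = f x + c * (L * d +
    L / d / n%:R ^+ 2 * (n%:R * x * (1 - x) + (n%:R * x - n%:R * x) ^+ 2)).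
  rewrite /q; under [X in bernstein n X]funext do rewrite addrA.
  by rewrite bernstein_sqr; ring.
rewrite ler_distl; apply/andP; split.
  apply: le_trans (@bernstein_le R x n (q (-1)) _ x01 _); first by rewrite shift; lra.
  by move=> k /key; rewrite /q ler_distl => /andP[]; lra.
apply: (le_trans (@bernstein_le R x n _ (q 1) x01 _)); last by rewrite shift; lra.
by move=> k /key; rewrite /q ler_distl => /andP[]; lra.
Qed.

Lemma lipschitz_poly_approx (R : realType) (f : R -> R) (a b L e : R) :
  a < b -> 0 <= L -> 0 < e ->
  (forall x y, a <= x <= b -> a <= y <= b -> `|f x - f y| <= L * `|x - y|) ->
  exists p : {poly R}, forall x, a <= x <= b -> `|p.[x] - f x| <= e.
Proof.
move=> ab L0 e0 fL; have ab' : 0 < b - a by rewrite subr_gt0.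
have [|||p hp] := @lipschitz_poly_approx01 R (fun x => f (a + (b - a) * x)) (L * (b - a)) e.
- by rewrite mulr_ge0// ltW.
- exact: e0.
- move=> x y x01 y01; rewrite -mulrA.
  have {3}-> : b - a = `|b - a| by rewrite gtr0_norm.
  rewrite -normrM.
  have -> : (b - a) * (x - y) = (a + (b - a) * x) - (a + (b - a) * y) by ring.
  by apply: fL; nra.
exists (p \Po ((b - a)^-1 *: ('X - a%:P))) => x xab.
rewrite horner_comp !hornerE /=.
have -> : f x = f (a + (b - a) * ((b - a)^-1 * (x - a))).
  by congr f; field; rewrite gt_eqF.
apply: hp; rewrite mulrC divr_ge0 ?ler_pdivrMr// ?mul1r; lra.
Qed.

Lemma powR_lipschitz (R : realType) (s a b : R) : 0 < a ->
  exists2 L, 0 <= L & forall x y, a <= x <= b -> a <= y <= b ->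
    `|x `^ s - y `^ s| <= L * `|x - y|.
Proof.
move=> a0; exists (`|s| * (a `^ (s - 1) + b `^ (s - 1))).
  by rewrite mulr_ge0// addr_ge0// powR_ge0.
have main x y : a <= x -> x < y -> y <= b ->
    `|x `^ s - y `^ s| <= `|s| * (a `^ (s - 1) + b `^ (s - 1)) * `|x - y|.
  move=> ax xy yb; have x0 := lt_le_trans a0 ax.
  have d (z : R) : 0 < z -> is_derive z 1 (fun u => u `^ s) (s * z `^ (s - 1)).
    by move=> z0; exact: is_derive1_powR.
  have [z||c] := @MVT R (fun u => u `^ s) (fun u => s * u `^ (s - 1)) x y xy.
  - by rewrite in_itv/= => /andP[xz _]; apply/d/(lt_trans x0).
  - apply: derivable_within_continuous => z; rewrite in_itv/= => /andP[xz _].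
    by have [] := d z (lt_le_trans x0 xz).
  rewrite in_itv/= => /andP[xc cy] h.
  rewrite distrC h !normrM (distrC y) ler_wpM2r// ler_wpM2l//.
  have c0 := lt_trans x0 xc.
  have cb : c <= b := le_trans (ltW cy) yb.
  have ac : a <= c := le_trans ax (ltW xc).
  rewrite ger0_norm ?powR_ge0//.
  have [s1|s1] := leP 1 s.
    apply: ler_wpDl; rewrite ?powR_ge0//.
    by apply: ge0_ler_powR; rewrite ?subr_ge0 ?nnegrE // ?(le_trans (ltW c0)) // ltW.
  apply: ler_wpDr; rewrite ?powR_ge0//.
  have -> : s - 1 = - (1 - s) by ring.
  rewrite !powRN lef_pV2 ?posrE ?powR_gt0//.
  by apply: ge0_ler_powR; rewrite ?subr_ge0 ?nnegrE ?(ltW s1)// ltW.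
move=> x y /andP[ax xb] /andP[ay yb]; have [xy|xy|->] := ltgtP x y.
- exact: main.
- by rewrite distrC (distrC x) main.
- by rewrite !subrr normr0 mulr0.
Qed.

Lemma horner_ge0_adherent (R : realType) (p : {poly R}) (c : R) :
  (forall e, 0 < e -> exists u, `|c - u| < e /\ 0 <= p.[u]) -> 0 <= p.[c].
Proof.
move=> h; rewrite leNgt; apply/negP => pc.
have [e /= e0 he] := @continuous_horner R p c _ (@open_nbhs_nbhs _ _ _ (conj (@open_lt R 0) pc)).
have [u [cu pu]] := h e e0.
by have := he u cu; rewrite /= ltNge pu.
Qed.

Lemma horner_ge0_right (R : realType) (p : {poly R}) (c b : R) : c < b ->
  (forall u, c < u <= b -> 0 <= p.[u]) -> 0 <= p.[c].
Proof.
move=> cb h; apply: horner_ge0_adherent => e e0.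
exists (Num.min (c + e / 2) b); split; last by apply: h; case: (ltP (c + e / 2) b) => ?; lra.
by case: (ltP (c + e / 2) b) => ?; rewrite distrC ger0_norm; lra.
Qed.

Lemma horner_ge0_left (R : realType) (p : {poly R}) (a c : R) : a < c ->
  (forall u, a <= u < c -> 0 <= p.[u]) -> 0 <= p.[c].
Proof.
move=> ac h; apply: horner_ge0_adherent => e e0.
exists (Num.max (c - e / 2) a); split; last by apply: h; case: (ltP (c - e / 2) a) => ?; lra.
by case: (ltP (c - e / 2) a) => ?; rewrite ger0_norm; lra.
Qed.

Lemma horner_bounded (R : realType) (p : {poly R}) (a b : R) :
  exists2 c, 0 <= c & forall u, a <= u <= b -> `|p.[u]| <= c.
Proof.
have [ab|ba] := leP a b; last first.
  by exists 0 => // u /andP[au /(le_trans au)]; rewrite leNgt ba.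
have cp : {within `[a, b], continuous (fun u : R => `|p.[u]|)}%classic.
  apply: continuous_subspaceT => u; apply: (@continuous_comp _ _ _ (horner p) Num.norm).
    exact: continuous_horner.
  exact: norm_continuous.
have [c _ hc] := EVT_max ab cp.
by exists `|p.[c]| => // u uab; have := hc u; rewrite in_itv/= uab; exact.
Qed.

Section MomentFunctional.
Variables (R : realType) (a b : R) (L : {poly R} -> R).
Hypothesis LD : forall p q, L (p + q) = L p + L q.
Hypothesis LZ : forall c p, L (c *: p) = c * L p.
Hypothesis L_sqr : forall q, 0 <= L (q ^+ 2).
Hypothesis L_left : forall q, 0 <= L (('X - a%:P) * q ^+ 2).
Hypothesis L_right : forall q, 0 <= L ((b%:P - 'X) * q ^+ 2).

(* This positivity is stable under multiplication by [X - a], by [b - X] and by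
   squares, whereas positivity of [L p] alone is not. *)
Definition moment_pos (p : {poly R}) := forall q,
  [/\ 0 <= L (p * q ^+ 2), 0 <= L (p * ('X - a%:P) * q ^+ 2),
      0 <= L (p * (b%:P - 'X) * q ^+ 2) &
      0 <= L (p * (('X - a%:P) * (b%:P - 'X)) * q ^+ 2)].

Lemma moment_posD p p' : moment_pos p -> moment_pos p' -> moment_pos (p + p').
Proof.
move=> hp hp' q; have [h1 h2 h3 h4] := hp q; have [h1' h2' h3' h4'] := hp' q.
split; [have := addr_ge0 h1 h1' | have := addr_ge0 h2 h2' |
  have := addr_ge0 h3 h3' | have := addr_ge0 h4 h4']; by rewrite -LD -!mulrDl.
Qed.

Lemma moment_pos_left p : moment_pos p -> moment_pos (p * ('X - a%:P)).
Proof.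
move=> hp q; have [? h2 ? h4] := hp q; have [h1' ? h3' ?] := hp (('X - a%:P) * q).
split=> //.
- by move: h1'; congr (0 <= L _); ring.
- by move: h4; congr (0 <= L _); ring.
- by move: h3'; congr (0 <= L _); ring.
Qed.

Lemma moment_pos_right p : moment_pos p -> moment_pos (p * (b%:P - 'X)).
Proof.
move=> hp q; have [? ? h3 h4] := hp q; have [h1' h2' ? ?] := hp ((b%:P - 'X) * q).
split=> //.
- by move: h4; congr (0 <= L _); ring.
- by move: h1'; congr (0 <= L _); ring.
- by move: h2'; congr (0 <= L _); ring.
Qed.

Lemma moment_pos_sqr p r : moment_pos p -> moment_pos (p * r ^+ 2).
Proof.
move=> hp q; have [h1 h2 h3 h4] := hp (r * q).
split; [move: h1|move: h2|move: h3|move: h4]; congr (0 <= L _); ring.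
Qed.

Lemma moment_posC c : a < b -> 0 <= c -> moment_pos c%:P.
Proof.
move=> ab c0 q; rewrite -!mulrA !mul_polyC; split; rewrite LZ mulr_ge0//.
have -> : ('X - a%:P) * ((b%:P - 'X) * q ^+ 2) = (b - a)^-1 *:
    (('X - a%:P) * ((b%:P - 'X) * q) ^+ 2 + (b%:P - 'X) * (('X - a%:P) * q) ^+ 2).
  apply: (scalerI (_ : b - a != 0)); first by rewrite subr_eq0 gt_eqF.
  rewrite scalerA divff ?subr_eq0 ?gt_eqF// scale1r -mul_polyC rmorphB /=; ring.
rewrite LZ mulr_ge0 ?invr_ge0 ?subr_ge0 ?(ltW ab)// LD addr_ge0//.
Qed.

Lemma moment_pos_itv p : a < b -> (forall u, a <= u <= b -> 0 <= p.[u]) -> moment_pos p.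
Proof.
move=> ab; have [n] := ubnP (size p); elim: n p => // n IH p szp p_ge0.
have [c] : exists2 c, c \in `[a, b] & forall u, u \in `[a, b] -> p.[c] <= p.[u].
  by apply: EVT_min (ltW ab) _; apply: continuous_subspaceT; exact: continuous_horner.
rewrite in_itv/= => cab minc; have /andP[ac cb] := cab.
have /factor_theorem[r pE] : root (p - p.[c]%:P) c.
  by rewrite /root !hornerE subrr.
have {}pE : p = p.[c]%:P + r * ('X - c%:P) by rewrite -pE; ring.
have pc0 := p_ge0 c cab.
have [r0|rn0] := eqVneq r 0.
  by rewrite pE r0 mul0r addr0; exact: moment_posC.
have szr : (size r < n)%N.
  have szE : size (p - p.[c]%:P) = (size r).+1.
    have -> : p - p.[c]%:P = r * ('X - c%:P) by rewrite {1}pE; ring.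
    by rewrite size_Mmonic ?monicXsubC// size_XsubC addn2.
  rewrite -ltnS -szE ltnS; apply: leq_trans (size_polyD _ _) _.
  rewrite size_polyN geq_max -ltnS szp /=.
  apply: leq_trans (size_polyC_leq1 _) _.
  rewrite ltnNge; apply/negP; rewrite leqn0 => /eqP n0.
  move: szp szE; rewrite n0 ltnS leqn0 size_poly_eq0 => /eqP ->.
  by rewrite horner0 polyC0 subrr size_poly0.
have rE u : a <= u <= b -> 0 <= r.[u] * (u - c).
  move=> uab; have := minc u; rewrite in_itv/= uab => /(_ isT).
  by rewrite {2}pE !hornerE lerDl.
have r_right u : c < u <= b -> 0 <= r.[u].
  move=> /andP[cu ub]; have := rE u; rewrite ub (le_trans ac (ltW cu)) => /(_ isT).
  by rewrite pmulr_lge0// subr_gt0.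
have r_left u : a <= u < c -> 0 <= (- r).[u].
  move=> /andP[au uc]; have := rE u; rewrite au (le_trans (ltW uc) cb) => /(_ isT).
  by rewrite hornerN -[_ - c]opprB mulrN -mulNr pmulr_lge0// subr_gt0.
rewrite pE; apply: moment_posD; first exact: moment_posC.
move: ac; rewrite le_eqVlt => /predU1P[ac|ac].
  rewrite -ac; apply/moment_pos_left/IH => // u /andP[].
  rewrite le_eqVlt => /predU1P[<- _|au ub]; last by apply: r_right; rewrite -ac au.
  by apply: (horner_ge0_right ab) => v; rewrite ac; exact: r_right.
move: cb; rewrite le_eqVlt => /predU1P[cb|cb].
  have -> : r * ('X - c%:P) = (- r) * (b%:P - 'X) by rewrite cb; ring.
  apply/moment_pos_right/IH; rewrite ?size_polyN// => u /andP[au].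
  rewrite le_eqVlt => /predU1P[->|ub]; last by apply: r_left; rewrite cb au.
  by apply: (horner_ge0_left ab) => v; rewrite -cb; exact: r_left.
have rc0 : root r c.
  rewrite /root eq_le (horner_ge0_right cb r_right) andbT -oppr_ge0 -hornerN.
  exact: horner_ge0_left ac r_left.
have /factor_theorem[s sE] := rc0.
have -> : r * ('X - c%:P) = s * ('X - c%:P) ^+ 2 by rewrite sE; ring.
have s_right u : c < u <= b -> 0 <= s.[u].
  move=> cub; have := r_right u cub; rewrite sE !hornerE pmulr_lge0// subr_gt0.
  by case/andP: cub.
apply/moment_pos_sqr/IH => [|u /andP[au ub]].
  have sn0 : s != 0 by apply: contraNneq rn0 => s0; rewrite sE s0 mul0r.
  move: szr; rewrite sE size_Mmonic ?monicXsubC// size_XsubC addn2 /=.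
  exact: ltnW.
have [uc|uc|->] := ltgtP u c; last exact: horner_ge0_right cb s_right.
  have := r_left u; rewrite au uc sE => /(_ isT).
  by rewrite !hornerE -mulrN opprB pmulr_lge0// subr_gt0.
by apply: s_right; rewrite uc.
Qed.

Lemma moment_ge0 p : (exists2 u, a <= u & u <= b) ->
  (forall u, a <= u <= b -> 0 <= p.[u]) -> 0 <= L p.
Proof.
move=> [u0 au0 u0b] p_ge0; have := le_trans au0 u0b.
rewrite le_eqVlt => /predU1P[ab|ab]; last first.
  by have [+ _ _ _] := moment_pos_itv ab p_ge0 1; rewrite expr1n mulr1.
have LN q : L (- q) = - L q by rewrite -scaleN1r LZ mulN1r.
have L_a q : L (('X - a%:P) * q ^+ 2) = 0.
  apply/eqP; rewrite eq_le L_left andbT -oppr_ge0 -LN -mulNr opprB ab.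
  exact: L_right.
have /factor_theorem[r pE] : root (p - p.[a]%:P) a.
  by rewrite /root !hornerE subrr.
have {}pE : p = p.[a]%:P + 4^-1 *: (('X - a%:P) * (r + 1) ^+ 2 - ('X - a%:P) * (r - 1) ^+ 2).
  apply: (addIr (- p.[a]%:P)); rewrite pE -mulrBr.
  have -> : (r + 1) ^+ 2 - (r - 1) ^+ 2 = 4 *: r.
    by rewrite scaler_nat; ring.
  rewrite -scalerAr scalerA mulVf ?pnatr_eq0// scale1r; ring.
have c0 : 0 <= p.[a] by apply: p_ge0; rewrite lexx ab lexx.
rewrite pE LD LZ LD LN !L_a subrr mulr0 addr0 -[_%:P]mulr1 mul_polyC LZ.
by apply: mulr_ge0 => //; rewrite -[1](expr1n _ 2).
Qed.

End MomentFunctional.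

(** * Operators and their functional calculus *)

Section RealInner.
Local Open Scope complex_scope.
Variables (R : realType) (H : completeNormedModType R[i]).
Variable dot : {dot H for (@Num.conj R[i])}.
Hypothesis hdot : hilbert_inner dot.

Definition ip (x y : H) : R := complex.Re (dot x y).
Definition rnorm (x : H) : R := complex.Re `|x|.

Lemma ReD (z w : R[i]) : complex.Re (z + w) = complex.Re z + complex.Re w.
Proof. by case: z w => [? ?] [? ?]. Qed.

Lemma ReN (z : R[i]) : complex.Re (- z) = - complex.Re z.
Proof. by case: z. Qed.

Lemma dotC x y : dot y x = Num.conj (dot x y).
Proof. by rewrite hermC /= expr0 mul1r. Qed.

Lemma ipC x y : ip x y = ip y x.
Proof. by rewrite /ip [dot y x]dotC; case: (dot x y). Qed.

Lemma ipDl x y z : ip (x + y) z = ip x z + ip y z.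
Proof. by rewrite /ip linearDl ReD. Qed.

Lemma ipZl (c : R) x z : ip (c%:C *: x) z = c * ip x z.
Proof. by rewrite /ip linearZl_LR /=; case: (dot x z) => u v /=; rewrite mul0r subr0. Qed.

Lemma ipNl x z : ip (- x) z = - ip x z.
Proof. by rewrite /ip linearNl ReN. Qed.

Lemma ipDr x y z : ip x (y + z) = ip x y + ip x z.
Proof. by rewrite !(ipC x) ipDl. Qed.

Lemma ipZr (c : R) x z : ip x (c%:C *: z) = c * ip x z.
Proof. by rewrite !(ipC x) ipZl. Qed.

Lemma ipNr x z : ip x (- z) = - ip x z.
Proof. by rewrite !(ipC x) ipNl. Qed.

Lemma ipBl x y z : ip (x - y) z = ip x z - ip y z.
Proof. by rewrite ipDl ipNl. Qed.

Lemma ipBr x y z : ip x (y - z) = ip x y - ip x z.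
Proof. by rewrite ipDr ipNr. Qed.

Lemma ip0l x : ip 0 x = 0.
Proof. by have := ipBl 0 0 x; rewrite !subrr. Qed.

Lemma ip0r x : ip x 0 = 0.
Proof. by rewrite ipC ip0l. Qed.

Lemma normE x : `|x| = (rnorm x)%:C.
Proof. by rewrite /rnorm (RRe_real (ger0_real (normr_ge0 x))). Qed.

Lemma rnorm_ge0 x : 0 <= rnorm x.
Proof. by have := normr_ge0 x; rewrite normE lecR. Qed.

Lemma rnorm_le (c : R) x y : (`|x| <= c%:C * `|y|) = (rnorm x <= c * rnorm y).
Proof. by rewrite !normE -rmorphM lecR. Qed.

Lemma rnorm_triangle x y : rnorm (x + y) <= rnorm x + rnorm y.
Proof. by have := ler_normD x y; rewrite !normE -rmorphD lecR. Qed.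

Lemma rnorm_eq0 x : rnorm x = 0 -> x = 0.
Proof. by move=> h; apply/eqP; rewrite -normr_eq0 normE h. Qed.

Lemma rnormN x : rnorm (- x) = rnorm x.
Proof. by rewrite /rnorm normrN. Qed.

Lemma rnorm0 : rnorm 0 = 0.
Proof. by rewrite /rnorm normr0. Qed.

Lemma rnormZC (c : R[i]) x : rnorm (c *: x) = complex.Re `|c| * rnorm x.
Proof. by rewrite /rnorm normrZ normE normc_def /= mul0r subr0. Qed.

Lemma rnormZ (c : R) x : rnorm (c%:C *: x) = `|c| * rnorm x.
Proof. by rewrite rnormZC normc_def /= expr0n addr0 sqrtr_sqr. Qed.

Lemma ip_rnorm x : ip x x = rnorm x ^+ 2.
Proof. by rewrite /ip hdot normE -rmorphXn. Qed.

Lemma ip_ge0 x : 0 <= ip x x.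
Proof. by rewrite ip_rnorm sqr_ge0. Qed.

Lemma ip_gt0 x : x != 0 -> 0 < ip x x.
Proof.
move=> x0; rewrite lt0r ip_ge0 andbT ip_rnorm sqrf_eq0.
by apply: contra x0 => /eqP/rnorm_eq0/eqP.
Qed.

Lemma ip_eq0 x : ip x x = 0 -> x = 0.
Proof. by move=> h; apply/eqP; apply/negPn/negP => /ip_gt0; rewrite h ltxx. Qed.

Lemma form_CauchySchwarz (F : H -> H -> R) x y :
  (forall u v, F u v = F v u) -> (forall u v w, F (u + v) w = F u w + F v w) ->
  (forall (c : R) u w, F (c%:C *: u) w = c * F u w) -> (forall u, 0 <= F u u) ->
  F x y ^+ 2 <= F x x * F y y.
Proof.
move=> FC FD FZ F0.
have h (c d : R) : 0 <= c ^+ 2 * F x x + 2 * (c * d * F x y) + d ^+ 2 * F y y.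
  apply: le_trans (F0 (c%:C *: x + d%:C *: y)) _; rewrite le_eqVlt; apply/orP; left.
  rewrite FD !FZ !(FC _ (_ + _)) !FD !FZ (FC y x); apply/eqP; ring.
have [y0|y0] := eqVneq (F y y) 0.
  rewrite y0 mulr0; have [->|q0] := eqVneq (F x y) 0; first by rewrite expr0n.
  have := h 1 (- ((F x x + 1) / (2 * F x y))); rewrite y0 mulr0 addr0.
  have -> : 1 * - ((F x x + 1) / (2 * F x y)) * F x y = - (F x x + 1) / 2 by field.
  lra.
have yp : 0 < F y y by rewrite lt0r y0 F0.
have := h (F y y) (- F x y); set p := F x x; set q := F x y; set r := F y y in yp *.
have -> : r ^+ 2 * p + 2 * (r * - q * q) + (- q) ^+ 2 * r = r * (p * r - q ^+ 2) by ring.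
by rewrite pmulr_rge0// subr_ge0.
Qed.

Lemma ip_CauchySchwarz x y : ip x y ^+ 2 <= ip x x * ip y y.
Proof.
by apply: form_CauchySchwarz; [exact: ipC|exact: ipDl|exact: ipZl|exact: ip_ge0].
Qed.

Lemma ip_le_rnorm x y : `|ip x y| <= rnorm x * rnorm y.
Proof.
rewrite -ler_sqr ?nnegrE ?mulr_ge0 ?rnorm_ge0//.
by rewrite real_normK ?num_real// exprMn -!ip_rnorm ip_CauchySchwarz.
Qed.

Lemma lin0 (T : H -> H) : linear T -> T 0 = 0.
Proof. by move=> hT; have := hT (-1) 0 0; rewrite scaler0 addr0 scaleN1r addNr. Qed.

Lemma linD (T : H -> H) : linear T -> forall x y, T (x + y) = T x + T y.
Proof. by move=> hT x y; have := hT 1 x y; rewrite !scale1r. Qed.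

Lemma linZ (T : H -> H) : linear T -> forall c x, T (c *: x) = c *: T x.
Proof. by move=> hT c x; have := hT c x 0; rewrite !addr0 (lin0 hT) addr0. Qed.

Lemma linN (T : H -> H) : linear T -> forall x, T (- x) = - T x.
Proof. by move=> hT x; rewrite -[in LHS]scaleN1r linZ// scaleN1r. Qed.

Lemma linB (T : H -> H) : linear T -> forall x y, T (x - y) = T x - T y.
Proof. by move=> hT x y; rewrite linD// linN. Qed.

Lemma bounded_rnorm (T : H -> H) : bounded_operator T ->
  exists2 c : R, 0 <= c & forall x, rnorm (T x) <= c * rnorm x.
Proof.
move=> [_ [c hc]]; exists `|c| => // x.
have := hc x; rewrite rnorm_le => h; apply: le_trans h _.
by rewrite ler_wpM2r ?rnorm_ge0// ler_norm.
Qed.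

Lemma rnorm_bounded (T : H -> H) (c : R) : linear T ->
  (forall x, rnorm (T x) <= c * rnorm x) -> bounded_operator T.
Proof. by move=> lT h; split => //; exists c => x; rewrite rnorm_le. Qed.

Lemma selfadjoint_ip (T : H -> H) : selfadjoint dot T -> forall x y, ip (T x) y = ip x (T y).
Proof. by move=> h x y; rewrite /ip h. Qed.

Lemma ip_selfadjoint (T : H -> H) : linear T -> (forall x y, ip (T x) y = ip x (T y)) ->
  selfadjoint dot T.
Proof.
move=> lT h x y; apply/eqP; rewrite eq_complex; apply/andP; split; apply/eqP.
  exact: h.
have := h x ('i *: y); rewrite linZ// /ip !linearZr_LR /=.
by case: (dot _ _) => a b; case: (dot _ _) => a' b' /=; rewrite !mul0r !mulN1r !sub0r !opprK.
Qed.

Lemma psdP (T : H -> H) : psd dot T <-> selfadjoint dot T /\ forall x, 0 <= ip (T x) x.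
Proof.
split=> -[sT h]; split=> // x; first by have := h x; rewrite lecE => /andP[].
have : dot (T x) x = Num.conj (dot (T x) x) by rewrite -dotC sT.
rewrite lecE -[complex.Re (dot _ _)]/(ip (T x) x) h andbT.
by case: (dot _ _) => a b [] /= hb; apply/eqP; lra.
Qed.

Lemma selfadjoint_scale (c : R) : selfadjoint dot (scale_op c idfun).
Proof.
move=> x y; rewrite /scale_op linearZl_LR linearZr_LR /=; congr (_ * _).
by apply/eqP; rewrite eq_complex /= oppr0 !eqxx.
Qed.

Lemma selfadjointD (S T : H -> H) : selfadjoint dot S -> selfadjoint dot T ->
  selfadjoint dot (S + T).
Proof. by move=> hS hT x y; rewrite /= linearDl linearDr /= hS hT. Qed.

Lemma selfadjointN (T : H -> H) : selfadjoint dot T -> selfadjoint dot (- T).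
Proof. by move=> hT x y; rewrite /= linearNl linearNr /= hT. Qed.

Lemma op_boundsP (a b : R) (T : H -> H) : op_bounds dot a b T <->
  selfadjoint dot T /\ forall x, a * ip x x <= ip (T x) x <= b * ip x x.
Proof.
split=> [[/psdP[s1 h1] /psdP[s2 h2]]|[sT h]].
  split=> [|x].
    have -> : T = (T - scale_op a idfun) + scale_op a idfun by rewrite subrK.
    by apply: selfadjointD => //; exact: selfadjoint_scale.
  have := h1 x; have := h2 x; rewrite !ipBl !ipZl /=; lra.
split; apply/psdP; split=> [|x].
- by apply: selfadjointD => //; apply/selfadjointN/selfadjoint_scale.
- have := h x; rewrite ipBl ipZl /=; lra.
- by apply: selfadjointD; [exact: selfadjoint_scale|exact: selfadjointN].
- have := h x; rewrite ipBl ipZl /=; lra.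
Qed.

End RealInner.

Section Horner.
Local Open Scope complex_scope.
Variables (R : realType) (H : completeNormedModType R[i]).
Implicit Types (T : H -> H) (p q : {poly R}).

Lemma op_horner_wide p T n x : (size p <= n)%N ->
  op_horner p T x = \sum_(i < n) (p`_i)%:C *: iter i T x.
Proof.
move=> sn; rewrite /op_horner (big_ord_widen n (fun i => (p`_i)%:C *: iter i T x) sn).
rewrite big_mkcond /=; apply: eq_bigr => i _; case: ltnP => // si.
by rewrite nth_default// scale0r.
Qed.

Lemma op_hornerD p q T x : op_horner (p + q) T x = op_horner p T x + op_horner q T x.
Proof.
have hp := leq_maxl (size p) (size q); have hq := leq_maxr (size p) (size q).
rewrite (op_horner_wide _ _ hp) (op_horner_wide _ _ hq) (op_horner_wide _ _ (size_polyD p q)).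
by rewrite -big_split; apply: eq_bigr => i _; rewrite /= coefD rmorphD scalerDl.
Qed.

Lemma op_hornerZ c p T x : op_horner (c *: p) T x = c%:C *: op_horner p T x.
Proof.
rewrite (op_horner_wide _ _ (size_scale_leq c p)) scaler_sumr.
by apply: eq_bigr => i _; rewrite coefZ rmorphM scalerA.
Qed.

Lemma op_hornerC c T x : op_horner c%:P T x = c%:C *: x.
Proof.
by rewrite (op_horner_wide _ _ (size_polyC_leq1 c)) big_ord1 coefC eqxx.
Qed.

Lemma op_horner0 T x : op_horner 0 T x = 0.
Proof. by rewrite /op_horner size_poly0 big_ord0. Qed.

Lemma op_hornerMX p T x : op_horner (p * 'X) T x = op_horner p T (T x).
Proof.
have sz : (size (p * 'X)%R <= (size p).+1)%N.
  by rewrite (leq_trans (size_polyMleq _ _))// size_polyX addn2.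
rewrite (op_horner_wide _ _ sz) big_ord_recl coefMX eqxx scale0r add0r.
by apply: eq_bigr => i _; rewrite coefMX /= -iterSr.
Qed.

Lemma op_hornerX T x : op_horner 'X T x = T x.
Proof. by rewrite -['X]mul1r op_hornerMX op_hornerC scale1r. Qed.

Lemma op_hornerN p T x : op_horner (- p) T x = - op_horner p T x.
Proof. by rewrite -scaleN1r op_hornerZ rmorphN1 scaleN1r. Qed.

Lemma op_hornerB p q T x : op_horner (p - q) T x = op_horner p T x - op_horner q T x.
Proof. by rewrite op_hornerD op_hornerN. Qed.

Lemma iter_linear T n : linear T -> linear (iter n T).
Proof. by move=> lT; elim: n => [|n IH] a x y; rewrite ?iterS ?IH ?lT. Qed.

Lemma op_horner_linear p T : linear T -> linear (op_horner p T).
Proof.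
move=> lT c x y; rewrite /op_horner scaler_sumr -big_split; apply: eq_bigr => i _ /=.
by rewrite (iter_linear _ lT) scalerDr !scalerA mulrC.
Qed.

Lemma op_hornerM p q T x : linear T ->
  op_horner (p * q) T x = op_horner p T (op_horner q T x).
Proof.
move=> lT; have comm r y : T (op_horner r T y) = op_horner r T (T y).
  elim/poly_ind: r y => [|r c IH] y; first by rewrite !op_horner0 lin0.
  by rewrite !op_hornerD !op_hornerMX !op_hornerC linD// IH linZ.
elim/poly_ind: p x => [|p c IH] x; first by rewrite mul0r !op_horner0.
rewrite mulrDl !op_hornerD mulrAC !op_hornerMX comm IH.
by rewrite mul_polyC op_hornerZ op_hornerC.
Qed.

End Horner.

Section Positivity.
Local Open Scope complex_scope.
Variables (R : realType) (H : completeNormedModType R[i]).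
Variable dot : {dot H for (@Num.conj R[i])}.
Hypothesis hdot : hilbert_inner dot.
Variables (a b : R) (T : H -> H).
Hypotheses (lT : linear T) (bT : op_bounds dot a b T).
Local Notation ip := (ip dot).

Lemma op_horner_ip p x y : ip (op_horner p T x) y = ip x (op_horner p T y).
Proof.
have sT := selfadjoint_ip (proj1 ((op_boundsP dot a b T).1 bT)).
elim/poly_ind: p x y => [|p c IH] x y; first by rewrite !op_horner0 ip0l ip0r.
rewrite !op_hornerD !op_hornerC ipDl ipDr ipZl ipZr; congr (_ + _).
by rewrite op_hornerMX IH sT -op_hornerX -op_hornerM// mulrC.
Qed.

Lemma op_bounds_itv (x : H) : x != 0 -> a <= b.
Proof.
move=> x0; have [_ /(_ x)] := (op_boundsP dot a b T).1 bT.
by move=> /andP[h1 h2]; have := le_trans h1 h2; rewrite ler_pM2r// ip_gt0.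
Qed.

Lemma op_horner_ge0 p x : (forall u, a <= u <= b -> 0 <= p.[u]) ->
  0 <= ip (op_horner p T x) x.
Proof.
move=> hp; have [->|x0] := eqVneq x 0; first by rewrite ip0r.
have [sT hT] := (op_boundsP dot a b T).1 bT.
pose L q := ip (op_horner q T x) x.
apply: (@moment_ge0 R a b L) hp.
- by move=> q r; rewrite /L op_hornerD ipDl.
- by move=> c q; rewrite /L op_hornerZ ipZl.
- by move=> q; rewrite /L expr2 op_hornerM// op_horner_ip ip_ge0.
- move=> q; rewrite /L (_ : _ * _ = q * (('X - a%:P) * q)); last by ring.
  rewrite op_hornerM// op_horner_ip op_hornerM// op_hornerB op_hornerX op_hornerC.
  by have /andP[h _] := hT (op_horner q T x); rewrite ipBl ipZl subr_ge0.
- move=> q; rewrite /L (_ : _ * _ = q * ((b%:P - 'X) * q)); last by ring.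
  rewrite op_hornerM// op_horner_ip op_hornerM// op_hornerB op_hornerX op_hornerC.
  by have /andP[_ h] := hT (op_horner q T x); rewrite ipBl ipZl subr_ge0.
- by exists a => //; exact: op_bounds_itv x0.
Qed.

Lemma op_horner_rnorm p e x : 0 <= e -> (forall u, a <= u <= b -> `|p.[u]| <= e) ->
  rnorm (op_horner p T x) <= e * rnorm x.
Proof.
move=> e0 hp; rewrite -ler_sqr ?nnegrE ?mulr_ge0 ?rnorm_ge0//.
rewrite exprMn -!(ip_rnorm hdot).
have := @op_horner_ge0 ((e ^+ 2)%:P - p ^+ 2) x.
rewrite op_hornerB op_hornerC expr2 op_hornerM// ipBl ipZl op_horner_ip subr_ge0; apply.
move=> u uab; rewrite !hornerE subr_ge0 -expr2 -[p.[u] ^+ 2]real_normK ?num_real//.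
by rewrite ler_sqr ?nnegrE// hp.
Qed.

End Positivity.

Lemma ler_of_eps (R : realType) (x y c : R) : 0 <= c ->
  (forall e, 0 < e -> x <= y + c * e) -> x <= y.
Proof.
move=> c0 h; rewrite leNgt; apply/negP => yx.
have c1 : 0 < c + 1 by lra.
have := h ((x - y) / (2 * (c + 1))); rewrite divr_gt0 ?mulr_gt0 ?subr_gt0// => /(_ isT).
rewrite mulrA -lerBlDl ler_pdivlMr ?mulr_gt0//; nra.
Qed.

Lemma rnorm_complete (R : realType) (H : completeNormedModType R[i]) (u : nat -> H) (c : R) :
  0 <= c -> (forall n k, rnorm (u n - u k) <= c * (n.+1%:R^-1 + k.+1%:R^-1)) ->
  exists l, forall n, rnorm (u n - l) <= c * n.+1%:R^-1.
Proof.
move=> c0 hu.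
have inv_small (e : R) : 0 < e -> exists N, forall n, (N <= n)%N -> n.+1%:R^-1 <= e.
  move=> e0; exists (Num.truncn e^-1) => n Nn.
  rewrite -[e]invrK lef_pV2 ?posrE ?invr_gt0//.
  by rewrite ltW// (lt_le_trans (truncnS_gt _))// ler_nat ltnS.
have : cvg (u @ \oo)%classic.
  apply/cauchy_cvgP/cauchy_exP => e e0.
  have Re0 : 0 < complex.Re e by move: e0; rewrite ltcE => /andP[].
  have c1 : 0 < 2 * (c + 1) by lra.
  have [N hN] := inv_small _ (divr_gt0 Re0 c1).
  exists (u N); exists N => // n /= Nn; rewrite -ball_normE /=.
  have -> : e = ((complex.Re e)%:C)%C by rewrite RRe_real// gtr0_real.
  rewrite normE ltcR; apply: (le_lt_trans (hu N n)).
  have h1 := hN _ (leqnn N); have h2 := hN _ Nn.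
  apply: (le_lt_trans (ler_wpM2l c0 (lerD h1 h2))).
  rewrite -mulr2n mulrnAr mulrA -mulrnAl ltr_pdivrMr//; nra.
move=> /cvg_ex[l ul]; exists l => n.
apply: (@ler_of_eps R _ _ (c + 1)); first by lra.
move=> e e0; have [N hN] := inv_small _ e0.
have /cvgrPdist_lt/(_ ((e%:C)%C)) := ul.
rewrite ltcR => /(_ e0)[K _ hK].
pose k := maxn N K.
have h1 : rnorm (u k - l) <= e.
  have := hK k; rewrite /= leq_maxr => /(_ isT).
  by rewrite normE ltcR -rnormN opprB => /ltW.
have h2 := hN k (leq_maxl _ _).
have := rnorm_triangle (u n - u k) (u k - l); rewrite subrKA => h3.
move: (hu n k) (ler_wpM2l c0 h2); move: (n.+1%:R^-1) (k.+1%:R^-1) => *; lra.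
Qed.

Section FunCalculus.
Variables (R : realType) (H : completeNormedModType R[i]).
Variable dot : {dot H for (@Num.conj R[i])}.
Hypothesis hdot : hilbert_inner dot.
Implicit Types (a b : R) (f g : R -> R) (T X Y : H -> H).
Local Notation ip := (ip dot).

Lemma fun_calculus_rnorm a b f T X : fun_calculus a b f T X ->
  forall e, 0 < e -> exists p : {poly R},
    (forall u, a <= u <= b -> `|p.[u] - f u| <= e) /\
    (forall x, rnorm (op_horner p T x - X x) <= e * rnorm x).
Proof.
move=> [_ h] e /h[p [h1 h2]]; exists p; split=> // x.
by rewrite -rnorm_le h2.
Qed.

Lemma fun_calculus_restrict a b c d f T X : a <= c -> d <= b ->
  fun_calculus a b f T X -> fun_calculus c d f T X.
Proof.
move=> ac db [bX h]; split=> // e /h[p [h1 h2]]; exists p; split=> // u /andP[cu ud].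
by apply: h1; rewrite (le_trans ac cu) (le_trans ud db).
Qed.

Lemma fun_calculus_ext a b f g T X : (forall u, a <= u <= b -> f u = g u) ->
  fun_calculus a b f T X -> fun_calculus a b g T X.
Proof.
move=> fg [bX h]; split=> // e /h[p [h1 h2]]; exists p; split=> // u uab.
by rewrite -fg// h1.
Qed.

Lemma fun_calculus_bounded a b f T X : fun_calculus a b f T X ->
  exists2 c, 0 <= c & forall u, a <= u <= b -> `|f u| <= c.
Proof.
move=> /fun_calculus_rnorm/(_ 1 ltr01)[p [hp _]].
have [c c0 hc] := horner_bounded p a b.
exists (c + 1) => [|u uab]; first lra.
have h := hc u uab.
have := ler_normB p.[u] (p.[u] - f u); rewrite subKr => h'.
have := hp u uab; lra.
Qed.

Lemma fun_calculus_uniq a b f T X Y : linear T -> op_bounds dot a b T ->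
  fun_calculus a b f T X -> fun_calculus a b f T Y -> X = Y.
Proof.
move=> lT bT fX fY; apply/funext => x; apply/eqP; rewrite -subr_eq0; apply/eqP/rnorm_eq0.
apply/eqP; rewrite eq_le rnorm_ge0 andbT.
apply: (@ler_of_eps R _ _ (4 * rnorm x)); first by rewrite mulr_ge0 ?rnorm_ge0.
move=> e e0; have [p [p1 p2]] := fun_calculus_rnorm fX e0.
have [q [q1 q2]] := fun_calculus_rnorm fY e0.
have pq u : a <= u <= b -> `|(p - q).[u]| <= 2 * e.
  move=> uab; have := p1 u uab; have := q1 u uab; rewrite !hornerE => h1 h2.
  have := ler_normB (p.[u] - f u) (q.[u] - f u); rewrite opprB addrA subrK; lra.
have := op_horner_rnorm hdot lT bT x (_ : 0 <= 2 * e) pq; rewrite mulr_ge0 ?(ltW e0)// => /(_ isT).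
rewrite op_hornerB => h1.
have h2 := p2 x; have h3 := q2 x; rewrite -rnormN opprB in h2.
have := rnorm_triangle (X x - op_horner p T x)
  (op_horner p T x - op_horner q T x + (op_horner q T x - Y x)).
have := rnorm_triangle (op_horner p T x - op_horner q T x) (op_horner q T x - Y x).
rewrite !subrKA; lra.
Qed.

Lemma fun_calculus_poly a b (p : {poly R}) T : bounded_operator T -> op_bounds dot a b T ->
  fun_calculus a b (fun u => p.[u]) T (op_horner p T).
Proof.
move=> [lT _] bT; split; last first.
  move=> e e0; exists p; split=> [u _|x]; first by rewrite subrr normr0 ltW.
  by rewrite rnorm_le subrr rnorm0 mulr_ge0 ?rnorm_ge0// ltW.
have [c c0 hc] := horner_bounded p a b.
apply: (@rnorm_bounded _ _ _ c); first exact: op_horner_linear.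
by move=> x; exact: op_horner_rnorm hc.
Qed.

Lemma fun_calculus_ip a b f T X : linear T -> op_bounds dot a b T ->
  fun_calculus a b f T X -> forall x y, ip (X x) y = ip x (X y).
Proof.
move=> lT bT fX x y; apply/eqP; rewrite -subr_eq0 -normr_le0.
apply: (@ler_of_eps R _ _ (2 * rnorm x * rnorm y)); first by rewrite !mulr_ge0 ?rnorm_ge0.
move=> e e0; have [p [_ p2]] := fun_calculus_rnorm fX e0.
have -> : ip (X x) y - ip x (X y) =
    ip x (op_horner p T y - X y) - ip (op_horner p T x - X x) y.
  by rewrite ipBl ipBr (op_horner_ip lT bT); ring.
have h1 := ip_le_rnorm hdot x (op_horner p T y - X y).
have h2 := ip_le_rnorm hdot (op_horner p T x - X x) y.
have h3 := ler_wpM2l (rnorm_ge0 x) (p2 y).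
have h4 := ler_wpM2r (rnorm_ge0 y) (p2 x).
apply: (le_trans (ler_normB _ _)); lra.
Qed.

Lemma fun_calculus_ge0 a b f T X : linear T -> op_bounds dot a b T ->
  fun_calculus a b f T X -> (forall u, a <= u <= b -> 0 <= f u) -> forall x, 0 <= ip (X x) x.
Proof.
move=> lT bT fX f0 x; rewrite -oppr_le0.
apply: (@ler_of_eps R _ _ (2 * rnorm x ^+ 2)); first by rewrite mulr_ge0 ?sqr_ge0.
move=> e e0; have [p [p1 p2]] := fun_calculus_rnorm fX e0.
have h0 : 0 <= ip (op_horner (p + e%:P) T x) x.
  apply: (op_horner_ge0 hdot lT bT) => u uab; rewrite !hornerE.
  by have := p1 u uab; rewrite ler_distl => /andP[+ _]; have := f0 u uab; lra.
rewrite op_hornerD op_hornerC ipDl ipZl (ip_rnorm hdot) in h0.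
have h1 := ip_le_rnorm hdot (op_horner p T x - X x) x.
have h2 := ler_wpM2r (rnorm_ge0 x) (p2 x).
rewrite ipBl ler_norml in h1.
by case/andP: h1 => _ h1; lra.
Qed.

Lemma fun_calculus_lin a b f g T X Y (c d : R) :
  fun_calculus a b f T X -> fun_calculus a b g T Y ->
  fun_calculus a b (fun u => c * f u + d * g u) T
    (fun x => (c%:C)%C *: X x + (d%:C)%C *: Y x).
Proof.
move=> fX fY; have [[lX _] _] := fX; have [[lY _] _] := fY.
have [cX cX0 hX] := bounded_rnorm (proj1 fX); have [cY cY0 hY] := bounded_rnorm (proj1 fY).
split.
  apply: (@rnorm_bounded _ _ _ (`|c| * cX + `|d| * cY)) => [k x y|x].
    rewrite lX lY !scalerDr !scalerA (mulrC _ k) (mulrC _ k) !addrA; congr (_ + _).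
    by rewrite -!addrA; congr (_ + _); rewrite addrC.
  apply: (le_trans (rnorm_triangle _ _)); rewrite !rnormZ mulrDl -!mulrA.
  by apply: lerD; apply: ler_wpM2l.
move=> e e0; have k0 : 0 < `|c| + `|d| + 1 by rewrite ltr_pwDr// addr_ge0.
have e'0 := divr_gt0 e0 k0; set e' := e / _ in e'0.
have [p [p1 p2]] := fun_calculus_rnorm fX e'0; have [q [q1 q2]] := fun_calculus_rnorm fY e'0.
have small : (`|c| + `|d|) * e' <= e.
  by rewrite /e' mulrA ler_pdivrMr// mulrC ler_wpM2l ?ltW// ltrDl.
clearbody e'.
exists (c *: p + d *: q); split=> [u uab|x].
  rewrite !hornerE (_ : _ - _ = c * (p.[u] - f u) + d * (q.[u] - g u)); last by ring.
  apply: le_trans small; rewrite mulrDl; apply: (le_trans (ler_normD _ _)).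
  by rewrite !normrM; apply: lerD; apply: ler_wpM2l => //; [exact: p1|exact: q1].
rewrite rnorm_le op_hornerD !op_hornerZ opprD addrACA -!scalerBr.
apply: le_trans (ler_wpM2r (rnorm_ge0 x) small).
apply: (le_trans (rnorm_triangle _ _)); rewrite !rnormZ !mulrDl -!mulrA.
by apply: lerD; apply: ler_wpM2l => //; [exact: p2|exact: q2].
Qed.

Lemma fun_calculus_mul a b f g T X Y : linear T -> op_bounds dot a b T ->
  fun_calculus a b f T X -> fun_calculus a b g T Y ->
  fun_calculus a b (fun u => f u * g u) T (X \o Y).
Proof.
move=> lT bT fX fY; have [[lX _] _] := fX; have [[lY _] _] := fY.
have [cX cX0 hX] := bounded_rnorm (proj1 fX); have [cY cY0 hY] := bounded_rnorm (proj1 fY).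
split.
  apply: (@rnorm_bounded _ _ _ (cX * cY)) => [k x y|x] /=; first by rewrite lY lX.
  by apply: (le_trans (hX _)); rewrite -mulrA ler_wpM2l.
have [F F0 hF] := fun_calculus_bounded fX; have [G G0 hG] := fun_calculus_bounded fY.
move=> e e0; have k0 : 0 < F + G + cY + 1 by lra.
pose e' := Num.min 1 (e / (F + G + cY + 1)).
have e'0 : 0 < e' by rewrite /e' lt_min ltr01 divr_gt0.
have e'1 : e' <= 1 by rewrite /e' ge_min lexx.
have e'e : (F + G + cY + 1) * e' <= e.
  rewrite mulrC -ler_pdivlMr//; rewrite /e' ge_min lexx orbT//.
have [p [p1 p2]] := fun_calculus_rnorm fX e'0; have [q [q1 q2]] := fun_calculus_rnorm fY e'0.
have pb u : a <= u <= b -> `|p.[u]| <= F + e'.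
  move=> uab; have := ler_normD (f u) (p.[u] - f u); rewrite addrCA subrr addr0.
  have := p1 u uab; have := hF u uab; lra.
exists (p * q); split=> [u uab|x].
  rewrite hornerM (_ : _ - _ = p.[u] * (q.[u] - g u) + (p.[u] - f u) * g u); last by ring.
  apply: (le_trans (ler_normD _ _)); rewrite !normrM.
  have h1 := ler_pM (normr_ge0 _) (normr_ge0 _) (pb u uab) (q1 u uab).
  have h2 := ler_pM (normr_ge0 _) (normr_ge0 _) (p1 u uab) (hG u uab).
  nra.
rewrite rnorm_le op_hornerM//=.
have -> : op_horner p T (op_horner q T x) - X (Y x) =
    op_horner p T (op_horner q T x - Y x) + (op_horner p T (Y x) - X (Y x)).
  by rewrite (linB (op_horner_linear p lT)) addrA subrK.
have h1 := op_horner_rnorm hdot lT bT (op_horner q T x - Y x) (_ : 0 <= F + e') pb.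
have {}h1 := h1 (addr_ge0 F0 (ltW e'0)).
have h2 := ler_wpM2l (addr_ge0 F0 (ltW e'0)) (q2 x).
have h3 := p2 (Y x); have h4 := ler_wpM2l (ltW e'0) (hY x).
apply: (le_trans (rnorm_triangle _ _)).
have : (F + e' + cY) * e' * rnorm x <= e * rnorm x.
  by apply: ler_wpM2r; [exact: rnorm_ge0|nra].
lra.
Qed.

Lemma fun_calculus_exists a b f T : bounded_operator T -> op_bounds dot a b T ->
  (forall e : R, 0 < e -> exists p : {poly R}, forall u, a <= u <= b -> `|p.[u] - f u| <= e) ->
  exists X, fun_calculus a b f T X.
Proof.
move=> hT bT hf; have lT := proj1 hT.
have invn0 n : 0 < n.+1%:R^-1 :> R by rewrite invr_gt0.
have [P hP] := choice (fun n => hf _ (invn0 n)).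
have close n k x : rnorm (op_horner (P n) T x - op_horner (P k) T x) <=
    rnorm x * (n.+1%:R^-1 + k.+1%:R^-1).
  rewrite -op_hornerB mulrC; apply: (op_horner_rnorm hdot lT bT).
    by rewrite addr_ge0// ltW.
  move=> u uab; rewrite !hornerE.
  have -> : (P n).[u] - (P k).[u] = ((P n).[u] - f u) - ((P k).[u] - f u) by ring.
  by apply: (le_trans (ler_normB _ _)); apply: lerD; exact: hP.
have /choice[X hX] x := rnorm_complete (rnorm_ge0 x) (fun n k => close n k x).
have lP n := op_horner_linear (P n) lT.
have tendsto (e : R) : 0 < e -> exists n, n.+1%:R^-1 <= e.
  move=> e0; exists (Num.truncn e^-1).
  by rewrite -[leRHS]invrK lef_pV2 ?posrE ?invr_gt0// ltW// truncnS_gt.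
exists X; split.
  have [c c0 hc] := bounded_rnorm (proj1 (fun_calculus_poly (P 0%N) hT bT)).
  apply: (@rnorm_bounded _ _ _ (c + 1)) => [k x y|x]; last first.
    have := rnorm_triangle (op_horner (P 0%N) T x) (X x - op_horner (P 0%N) T x).
    rewrite addrC subrK -[rnorm (X x - _)]rnormN opprB.
    by have := hX x 0%N; have := hc x; rewrite invr1 mulr1 mulrDl mul1r; lra.
  apply/eqP; rewrite -subr_eq0; apply/eqP/rnorm_eq0/eqP; rewrite eq_le rnorm_ge0 andbT.
  set cc := rnorm (k *: x + y) + complex.Re `|k| * rnorm x + rnorm y.
  have k0 : 0 <= complex.Re `|k| by have := normr_ge0 k; rewrite lecE => /andP[].
  apply: (@ler_of_eps R _ _ cc); first by rewrite /cc !addr_ge0 ?mulr_ge0 ?rnorm_ge0.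
  move=> e /tendsto[n ne].
  have -> : X (k *: x + y) - (k *: X x + X y) =
      - (op_horner (P n) T (k *: x + y) - X (k *: x + y)) +
      (k *: (op_horner (P n) T x - X x) + (op_horner (P n) T y - X y)).
    rewrite lP scalerBr; set A := k *: op_horner _ _ _; set B := op_horner _ _ y.
    by rewrite opprB (addrACA A) subrKA opprD.
  rewrite add0r; apply: (le_trans (rnorm_triangle _ _)); rewrite rnormN.
  have h1 := hX (k *: x + y) n; have h2 := hX x n; have h3 := hX y n.
  have h4 := rnorm_triangle (k *: (op_horner (P n) T x - X x)) (op_horner (P n) T y - X y).
  rewrite rnormZC in h4; have h5 := ler_wpM2l k0 h2.
  have h6 : cc * n.+1%:R^-1 <= cc * e.
    by apply: ler_wpM2l ne; rewrite /cc !addr_ge0 ?mulr_ge0 ?rnorm_ge0.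
  apply: le_trans h6; rewrite /cc.
  by move: h1 h2 h3 h4 h5; move: (n.+1%:R^-1) (complex.Re _) => *; lra.
move=> e e0; have [n ne] := tendsto e e0.
exists (P n); split=> [u uab|x]; first exact: le_trans (hP _ _ uab) ne.
rewrite rnorm_le; apply: (le_trans (hX x n)); rewrite mulrC.
by apply: ler_wpM2r; first exact: rnorm_ge0.
Qed.

End FunCalculus.

Section OperatorPower.
Variables (R : realType) (H : completeNormedModType R[i]).
Variable dot : {dot H for (@Num.conj R[i])}.
Hypothesis hdot : hilbert_inner dot.
Local Notation ip := (ip dot).

Lemma op_bounds_widen (a b c d : R) (T : H -> H) : c <= a -> b <= d ->
  op_bounds dot a b T -> op_bounds dot c d T.
Proof.
move=> ca bd /op_boundsP[sT hT]; apply/op_boundsP; split=> // x.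
have /andP[h1 h2] := hT x; have x0 := ip_ge0 hdot x; apply/andP; split.
  by apply: le_trans h1; apply: ler_wpM2r.
by apply: (le_trans h2); apply: ler_wpM2r.
Qed.

Lemma op_pow_calculus (a b s : R) (T : H -> H) : 0 < a -> bounded_operator T ->
  op_bounds dot a b T -> fun_calculus a b (fun u => u `^ s) T (op_pow dot T s).
Proof.
move=> a0 hT bT.
have ex (c d : R) : 0 < c -> c < d -> op_bounds dot c d T ->
    exists X, fun_calculus c d (fun u => u `^ s) T X.
  move=> c0 cd bT'; apply: (fun_calculus_exists hdot hT bT') => e e0.
  have [L L0 hL] := powR_lipschitz s d c0.
  exact: lipschitz_poly_approx cd L0 e0 hL.
have [a1 [b1 [a10 bT1 f1]]] : exists a b : R, [/\ 0 < a, op_bounds dot a b T &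
    fun_calculus a b (fun u => u `^ s) T (op_pow dot T s)].
  rewrite /op_pow; case: xgetP => [X -> //|none].
  have bT' := op_bounds_widen (lexx a) (_ : b <= Num.max a b + 1) bT.
  have {}bT' := bT' ltac:(by rewrite ler_wpDr// le_max lexx orbT).
  have [|Y fY] := ex a _ a0 _ bT'; first by rewrite ltr_pwDr// le_max lexx.
  by case: (none Y); exists a, (Num.max a b + 1).
pose lo := Num.min a a1; pose hi := Num.max lo (Num.max b b1) + 1.
have lo0 : 0 < lo by rewrite lt_min a0.
have lohi : lo < hi by rewrite ltr_pwDr// le_max lexx.
have [loa loa1] : lo <= a /\ lo <= a1 by rewrite !ge_min !lexx orbT.
have [bhi b1hi] : b <= hi /\ b1 <= hi.
  by split; rewrite ler_wpDr// !le_max lexx !orbT.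
have [Y fY] := ex lo hi lo0 lohi (op_bounds_widen loa bhi bT).
rewrite (fun_calculus_uniq hdot (proj1 hT) bT1 f1 (fun_calculus_restrict loa1 b1hi fY)).
exact: fun_calculus_restrict fY.
Qed.

Section Bounded.
Variables (a b : R) (T : H -> H).
Hypotheses (a_gt0 : 0 < a) (hT : bounded_operator T) (bT : op_bounds dot a b T).
Let lT := proj1 hT.
Local Notation pow := (op_pow dot T).
Let powT s := op_pow_calculus s a_gt0 hT bT.

Lemma op_pow_bounded s : bounded_operator (pow s).
Proof. exact: (proj1 (powT s)). Qed.

Lemma op_pow_ip s x y : ip (pow s x) y = ip x (pow s y).
Proof. exact: (fun_calculus_ip hdot lT bT (powT s)). Qed.

Lemma op_powD r s x : pow r (pow s x) = pow (r + s) x.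
Proof.
have h : fun_calculus a b (fun u => u `^ (r + s)) T (pow r \o pow s).
  apply: fun_calculus_ext (fun_calculus_mul hdot lT bT (powT r) (powT s)).
  by move=> u /andP[au _]; rewrite powRD// (gt_eqF (lt_le_trans a_gt0 au)) implybT.
by rewrite -(fun_calculus_uniq hdot lT bT h (powT (r + s))).
Qed.

Lemma op_pow1 x : pow 1 x = T x.
Proof.
rewrite -[RHS]op_hornerX (fun_calculus_uniq hdot lT bT (powT 1) (_ : _ _ _ _ _ (op_horner 'X T)))//.
apply: fun_calculus_ext (fun_calculus_poly hdot 'X hT bT) => u /andP[au _].
by rewrite hornerX powRr1// (le_trans _ au)// ltW.
Qed.

Lemma op_pow0 x : pow 0 x = x.
Proof.
rewrite -[RHS]scale1r -(op_hornerC 1 T).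
rewrite (fun_calculus_uniq hdot lT bT (powT 0) (_ : _ _ _ _ _ (op_horner 1%:P T)))//.
by apply: fun_calculus_ext (fun_calculus_poly hdot 1%:P hT bT) => u _; rewrite hornerC powRr0.
Qed.

Lemma op_pow_ge0 (c d e r s : R) :
  (forall u, a <= u <= b -> 0 <= c + d * u `^ r + e * u `^ s) ->
  forall x, 0 <= c * ip x x + d * ip (pow r x) x + e * ip (pow s x) x.
Proof.
move=> h x; have f1 := fun_calculus_lin d e (powT r) (powT s).
have f2 := fun_calculus_lin c 1 (fun_calculus_poly hdot 1%:P hT bT) f1.
have := fun_calculus_ge0 hdot lT bT f2 _ x.
rewrite /= op_hornerC scale1r !(ipDl, ipZl) mul1r addrA; apply=> u uab.
by rewrite hornerC mulr1 mul1r addrA h.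
Qed.

Lemma op_pow_bounds (c d s : R) : (forall u, a <= u <= b -> c <= u `^ s <= d) ->
  op_bounds dot c d (pow s).
Proof.
move=> h; apply/op_boundsP; split=> [|x].
  by apply: ip_selfadjoint; [exact: (proj1 (op_pow_bounded s))|exact: op_pow_ip].
have h1 : 0 <= - c * ip x x + 1 * ip (pow s x) x + 0 * ip (pow s x) x.
  by apply: op_pow_ge0 => u /h; lra.
have h2 : 0 <= d * ip x x + -1 * ip (pow s x) x + 0 * ip (pow s x) x.
  by apply: op_pow_ge0 => u /h; lra.
by apply/andP; split; lra.
Qed.

Lemma op_invE : op_inv T = pow (- 1).
Proof.
have inv1 x : T (pow (- 1) x) = x by rewrite -[LHS]op_pow1 op_powD subrr op_pow0.
have inv2 x : pow (- 1) (T x) = x by rewrite -op_pow1 op_powD addNr op_pow0.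
rewrite /op_inv; case: xgetP => [X -> [_ _ XT]|none]; last first.
  by case: (none (pow (- 1))); split; [exact: op_pow_bounded|exact/funext..].
apply/funext => x; rewrite -{1}(inv1 x).
exact: (congr1 (@^~ (pow (- 1) x)) XT).
Qed.

Lemma op_pow_jensen t x : 0 <= t <= 1 -> 0 < ip (T x) x ->
  ip (pow t x) x <= ip x x `^ (1 - t) * ip (T x) x `^ t.
Proof.
move=> ht q0; have p0 : 0 < ip x x.
  by apply: (ip_gt0 hdot); apply: contraTneq q0 => ->; rewrite ip0r ltxx.
have l0 := divr_gt0 q0 p0; set l := _ / _ in l0.
have h : 0 <= (1 - t) * l `^ t * ip x x + t * l `^ (t - 1) * ip (pow 1 x) x +
    -1 * ip (pow t x) x.
  apply: op_pow_ge0 => u /andP[au _]; have u0 := lt_le_trans a_gt0 au.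
  by have := powR_tangent ht l0 u0; rewrite (powRr1 (ltW u0)); lra.
rewrite op_pow1 mulN1r subr_ge0 in h; apply: (le_trans h).
rewrite powRB ?(gt_eqF l0) ?implybT// powRr1 ?(ltW l0)//.
rewrite powRB ?(gt_eqF p0) ?implybT// (powRr1 (ltW p0)).
have -> : l `^ t = ip (T x) x `^ t / ip x x `^ t.
  by rewrite /l powRM ?invr_ge0 ?ltW// powR_inv// ltW.
have pt0 : 0 < ip x x `^ t by exact: powR_gt0.
rewrite le_eqVlt; apply/orP; left; apply/eqP.
by rewrite /l; field; rewrite !gt_eqF.
Qed.

Lemma op_pow_kantorovich t x : 0 <= t <= 1 -> 0 < ip (T x) x ->
  kantorovich a b t * (ip x x `^ (1 - t) * ip (T x) x `^ t) <= ip (pow t x) x.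
Proof.
move=> ht q0; have x0 : x != 0.
  by apply: contraTneq q0 => ->; rewrite ip0r ltxx.
have p0 := ip_gt0 hdot x0.
have [c [d [c0 d0 hcd hK]]] := powR_ge_chord ht a_gt0 (op_bounds_itv hdot bT x0).
apply: (le_trans (hK _ _ p0 q0)).
have h : 0 <= - c * ip x x + - d * ip (pow 1 x) x + 1 * ip (pow t x) x.
  apply: op_pow_ge0 => u uab; have /andP[au _] := uab.
  by rewrite powRr1 ?(le_trans _ au) ?(ltW a_gt0)//; have := hcd u uab; lra.
by rewrite op_pow1 in h; lra.
Qed.

End Bounded.
End OperatorPower.

(** * Comparison of the two means *)

Section MeanComparison.
Variables (R : realType) (H : completeNormedModType R[i]).
Variable dot : {dot H for (@Num.conj R[i])}.
Hypothesis hdot : hilbert_inner dot.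
Local Notation ip := (ip dot).

Lemma bounded_comp (S T : H -> H) : bounded_operator S -> bounded_operator T ->
  bounded_operator (S \o T).
Proof.
move=> hS hT; have [c c0 hc] := bounded_rnorm hS; have [d d0 hd] := bounded_rnorm hT.
apply: (@rnorm_bounded _ _ _ (c * d)) => [k x y|x] /=.
  by rewrite (proj1 hT) (proj1 hS).
by apply: (le_trans (hc _)); rewrite -mulrA ler_wpM2l.
Qed.

Lemma op_bounds_congr (m M l h : R) (S T : H -> H) : 0 <= m -> 0 <= M ->
  linear S -> (forall x y, ip (S x) y = ip x (S y)) ->
  (forall x, l * ip x x <= ip (S x) (S x) <= h * ip x x) ->
  linear T -> op_bounds dot m M T -> op_bounds dot (m * l) (M * h) (S \o T \o S).
Proof.
move=> m0 M0 lS sS hS lT /op_boundsP[sT hT]; apply/op_boundsP; split=> [|x /=].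
  apply: ip_selfadjoint => [k x y|x y] /=; first by rewrite lS lT lS.
  by rewrite sS (selfadjoint_ip sT) sS.
rewrite sS; have /andP[h1 h2] := hT (S x); have /andP[h3 h4] := hS x.
apply/andP; split.
  by apply: le_trans h1; rewrite -mulrA ler_wpM2l.
by apply: (le_trans h2); rewrite -mulrA ler_wpM2l.
Qed.

Lemma psd_CauchySchwarz (N : H -> H) x y : linear N ->
  (forall u v, ip (N u) v = ip u (N v)) -> (forall u, 0 <= ip (N u) u) ->
  ip (N x) y ^+ 2 <= ip (N x) x * ip (N y) y.
Proof.
move=> lN sN N0; apply: (@form_CauchySchwarz R H (fun u v => ip (N u) v)) => //.
- by move=> u v; rewrite sN ipC.
- by move=> u v w; rewrite linD// ipDl.
- by move=> k u w; rewrite linZ// ipZl.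
Qed.

Lemma psd_sqr_le (S : H -> H) (c : R) x : linear S ->
  (forall x y, ip (S x) y = ip x (S y)) -> (forall x, 0 <= ip (S x) x) ->
  (forall x, ip (S x) x <= c * ip x x) -> ip (S x) (S x) <= c * ip (S x) x.
Proof.
move=> lS sS S0 hS; have [e|n0] := eqVneq (ip (S x) (S x)) 0.
  by rewrite (ip_eq0 hdot e) !ip0l mulr0.
have p0 : 0 < ip (S x) (S x) by rewrite lt0r n0 ip_ge0.
rewrite -(ler_pM2r p0) -expr2; apply: (le_trans (psd_CauchySchwarz x (S x) lS sS S0)).
by rewrite mulrAC mulrC ler_wpM2r.
Qed.

Lemma kantorovich_ineq (N : H -> H) (m M : R) x : 0 < m -> m <= M -> linear N ->
  (forall x y, ip (N x) y = ip x (N y)) ->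
  (forall x, m * ip x x <= ip (N x) x <= M * ip x x) ->
  ip (N x) (N x) * ip x x <= (M + m) ^+ 2 / (4 * M * m) * ip (N x) x ^+ 2.
Proof.
move=> m0 mM lN sN hN; have M0 := lt_le_trans m0 mM.
pose S := fun x => N x - (m%:C)%C *: x.
have lS : linear S.
  by move=> k u v; rewrite /S lN scalerBr scalerDr !scalerA opprD addrACA (mulrC k).
have sS u v : ip (S u) v = ip u (S v) by rewrite /S ipBl ipBr ipZl ipZr sN.
have S0 u : 0 <= ip (S u) u by rewrite /S ipBl ipZl subr_ge0; case/andP: (hN u).
have hS u : ip (S u) u <= (M - m) * ip u u.
  by rewrite /S ipBl ipZl; case/andP: (hN u); lra.
have := psd_sqr_le x lS sS S0 hS.
rewrite /S !ipBl !ipBr !ipZl !ipZr -(sN x x) => h.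
have p0 := ip_ge0 hdot (N x); have q0 := ip_ge0 hdot x.
have r0 : 0 <= ip (N x) x by case/andP: (hN x) => + _; apply: le_trans; rewrite mulr_ge0// ltW.
move: h p0 q0 r0; move: (ip (N x) (N x)) (ip (N x) x) (ip x x) => p r q h p0 q0 r0.
rewrite mulrAC ler_pdivlMr ?mulr_gt0//.
have h1 : p + m * M * q <= (M + m) * r by lra.
have h2 : 0 <= p + m * M * q by rewrite addr_ge0// !mulr_ge0// ltW.
have h3 : (p + m * M * q) ^+ 2 <= ((M + m) * r) ^+ 2.
  by rewrite ler_sqr ?nnegrE// (le_trans h2).
rewrite exprMn in h3; apply: le_trans h3.
have := sqr_ge0 (p - m * M * q); lra.
Qed.

Lemma ip_inverse_ge (N N' : H -> H) (c : R) x : 0 < c -> linear N' ->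
  (forall x y, ip (N' x) y = ip x (N' y)) -> (forall x, N' (N x) = x) ->
  (forall x, 0 <= ip (N' x) x <= c^-1 * ip x x) -> c * ip x x <= ip (N x) x.
Proof.
move=> c0 lN' sN' NN hN'; have [->|x0] := eqVneq x 0; first by rewrite !ip0r mulr0.
have p0 := ip_gt0 hdot x0.
have N'0 u : 0 <= ip (N' u) u by case/andP: (hN' u).
have := psd_CauchySchwarz (N x) x lN' sN' N'0.
rewrite NN [ip x (N x)]ipC; have /andP[n0 h1] := hN' x.
have r0 : 0 <= ip (N x) x.
  by have /andP[h _] := hN' (N x); rewrite NN ipC in h.
move=> h; have := le_trans h (ler_wpM2l r0 h1); rewrite mulrA expr2 ler_pM2r//.
by rewrite ler_pdivlMr// mulrC.
Qed.

Section TwoOperators.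
Variables (A B : H -> H) (m M t : R).
Hypotheses (hA : bounded_operator A) (hB : bounded_operator B) (m0 : 0 < m) (mM : m <= M).
Hypotheses (bA : op_bounds dot m M A) (bB : op_bounds dot m M B) (ht : 0 <= t <= 1).
Let M0 : 0 < M. Proof. exact: lt_le_trans m0 mM. Qed.
Let lB := proj1 hB.

Lemma op_inv_bounds : op_bounds dot M^-1 m^-1 (op_inv A).
Proof.
rewrite (op_invE hdot m0 hA bA); apply: (op_pow_bounds hdot m0 hA bA) => u /andP[mu uM].
have u0 := lt_le_trans m0 mu.
by rewrite powR_inv1 ?(ltW u0)// !lef_pV2 ?posrE// uM.
Qed.

Lemma geomean_core_bounds :
  op_bounds dot (m / M) (M / m) (op_pow dot A (- 2^-1) \o B \o op_pow dot A (- 2^-1)).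
Proof.
apply: op_bounds_congr => //; rewrite ?(ltW m0) ?(ltW M0)//.
- exact: (proj1 (op_pow_bounded hdot m0 hA bA _)).
- exact: op_pow_ip m0 hA bA _.
move=> x; rewrite -(op_pow_ip hdot m0 hA bA) (op_powD hdot m0 hA bA).
rewrite (_ : - 2^-1 + - 2^-1 = - 1); last by lra.
rewrite -(op_invE hdot m0 hA bA); have /op_boundsP[_] := op_inv_bounds.
exact.
Qed.

Lemma op_core_bounded (S : H -> H) : bounded_operator S -> bounded_operator (S \o B \o S).
Proof. by move=> hS; exact: bounded_comp (bounded_comp hS hB) hS. Qed.

Let Ah := op_pow dot A 2^-1.
Let C := op_pow dot A (- 2^-1) \o B \o op_pow dot A (- 2^-1).

Let hC : bounded_operator C.
Proof. exact/op_core_bounded/(op_pow_bounded hdot m0 hA bA). Qed.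

Lemma geomean_ip x y : ip (geomean dot t A B x) y = ip x (geomean dot t A B y).
Proof.
have mM0 : 0 < m / M by rewrite divr_gt0.
rewrite /geomean /= (op_pow_ip hdot m0 hA bA).
by rewrite (op_pow_ip hdot mM0 hC geomean_core_bounds) (op_pow_ip hdot m0 hA bA).
Qed.

Lemma geomean_linear : linear (geomean dot t A B).
Proof.
have mM0 : 0 < m / M by rewrite divr_gt0.
have lA := proj1 (op_pow_bounded hdot m0 hA bA 2^-1).
have lC := proj1 (op_pow_bounded hdot mM0 hC geomean_core_bounds t).
by move=> k x y; rewrite /geomean /= lA lC lA.
Qed.

Lemma ip_B_bounds x : m * ip x x <= ip (B x) x <= M * ip x x.
Proof. by have /op_boundsP[_ /(_ x)] := bB. Qed.

Lemma ip_A_bounds x : m * ip x x <= ip (A x) x <= M * ip x x.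
Proof. by have /op_boundsP[_ /(_ x)] := bA. Qed.

Lemma geomean_ip_ge x : x != 0 ->
  kantorovich (m / M) (M / m) t * (ip (A x) x `^ (1 - t) * ip (B x) x `^ t) <=
  ip (geomean dot t A B x) x.
Proof.
move=> x0; have p0 := ip_gt0 hdot x0.
have mM0 : 0 < m / M by rewrite divr_gt0.
have hpow := op_powD hdot m0 hA bA.
have Cx : ip (C (Ah x)) (Ah x) = ip (B x) x.
  rewrite /C /Ah /= (op_pow_ip hdot m0 hA bA) hpow addNr.
  by rewrite (op_pow0 hdot m0 hA bA).
have Ax : ip (Ah x) (Ah x) = ip (A x) x.
  rewrite /Ah -(op_pow_ip hdot m0 hA bA) hpow.
  by rewrite (_ : 2^-1 + 2^-1 = 1 :> R) ?(op_pow1 hdot m0 hA bA)//; lra.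
have := @op_pow_kantorovich _ _ _ hdot _ _ _ mM0 hC geomean_core_bounds t (Ah x) ht.
rewrite Cx Ax {2}/Ah -(op_pow_ip hdot m0 hA bA); apply.
by have /andP[h _] := ip_B_bounds x; apply: lt_le_trans h; rewrite mulr_gt0.
Qed.

Let Ai := op_inv A.
Let Mi0 : 0 < M^-1. Proof. by rewrite invr_gt0. Qed.
Let hAi : bounded_operator Ai.
Proof. by rewrite /Ai (op_invE hdot m0 hA bA); exact: op_pow_bounded bA _. Qed.
Let bAi : op_bounds dot M^-1 m^-1 Ai := op_inv_bounds.
Let P := op_pow dot Ai 2^-1.
Let P' := op_pow dot Ai (- 2^-1).
Let W := P' \o B \o P'.
Let Q := op_pow dot W 2^-1.
Let G := geomean dot 2^-1 Ai B.
Let GE : G = P \o Q \o P. Proof. by []. Qed.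

Let PP' x : P (P' x) = x.
Proof. by rewrite /P /P' (op_powD hdot Mi0 hAi bAi) subrr (op_pow0 hdot Mi0 hAi bAi). Qed.
Let P'P x : P' (P x) = x.
Proof. by rewrite /P /P' (op_powD hdot Mi0 hAi bAi) addNr (op_pow0 hdot Mi0 hAi bAi). Qed.
Let P'P' x : P' (P' x) = A x.
Proof.
have AiA : Ai (A x) = x.
  rewrite /Ai (op_invE hdot m0 hA bA) -[A x](op_pow1 hdot m0 hA bA).
  by rewrite (op_powD hdot m0 hA bA) addNr (op_pow0 hdot m0 hA bA).
rewrite /P' (op_powD hdot Mi0 hAi bAi) (_ : - 2^-1 + - 2^-1 = - 1); last by lra.
rewrite -{1}AiA -[Ai _](op_pow1 hdot Mi0 hAi bAi) (op_powD hdot Mi0 hAi bAi).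
by rewrite addNr (op_pow0 hdot Mi0 hAi bAi).
Qed.
Let PP x : P (P x) = Ai x.
Proof.
rewrite /P (op_powD hdot Mi0 hAi bAi) (_ : 2^-1 + 2^-1 = 1); last by lra.
exact: op_pow1 bAi _.
Qed.
Let sP x y : ip (P x) y = ip x (P y). Proof. exact: op_pow_ip Mi0 hAi bAi _ _ _. Qed.
Let sP' x y : ip (P' x) y = ip x (P' y). Proof. exact: op_pow_ip Mi0 hAi bAi _ _ _. Qed.
Let hP : bounded_operator P. Proof. exact: op_pow_bounded bAi _. Qed.
Let hP' : bounded_operator P'. Proof. exact: op_pow_bounded bAi _. Qed.
Let hW : bounded_operator W. Proof. exact: op_core_bounded. Qed.
Let mm0 : 0 < m * m. Proof. exact: mulr_gt0. Qed.
Let bW : op_bounds dot (m * m) (M * M) W.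
Proof.
apply: op_bounds_congr => //; rewrite ?(ltW m0) ?(ltW M0)//; first exact: (proj1 hP').
by move=> x; rewrite -sP' P'P' ip_A_bounds.
Qed.
Let hQ : bounded_operator Q. Proof. exact: op_pow_bounded bW _. Qed.
Let sQ x y : ip (Q x) y = ip x (Q y). Proof. exact: op_pow_ip mm0 hW bW _ _ _. Qed.
Let bQ : op_bounds dot m M Q.
Proof.
apply: (op_pow_bounds hdot mm0 hW bW) => u /andP[mu uM].
have u0 := lt_le_trans mm0 mu; rewrite powR12_sqrt ?(ltW u0)//.
have sqrtM (v : R) : 0 < v -> Num.sqrt (v * v) = v by move=> v0; rewrite -expr2 sqrtr_sqr gtr0_norm.
rewrite -{1}(sqrtM m m0) -(sqrtM M M0).
by rewrite ler_sqrt ?(ltW u0)// ler_sqrt ?mulr_ge0 ?(ltW M0)// mu.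
Qed.
Let mM0 : 0 < m / M. Proof. exact: divr_gt0. Qed.
Let hG : bounded_operator G. Proof. by rewrite GE; exact: bounded_comp (bounded_comp hP hQ) hP. Qed.
Let bG : op_bounds dot (m / M) (M / m) G.
Proof.
rewrite GE; apply: op_bounds_congr bQ; rewrite ?(ltW m0) ?(ltW M0)//.
- exact: (proj1 hP).
- by move=> x; rewrite -sP PP; have /op_boundsP[_] := bAi; exact.
- exact: (proj1 hQ).
Qed.
Let Gt := op_pow dot G t.
Let Gtn := op_pow dot G (- t).
Let sGt x y : ip (Gt x) y = ip x (Gt y). Proof. exact: op_pow_ip mM0 hG bG _ _ _. Qed.
Let sGtn x y : ip (Gtn x) y = ip x (Gtn y). Proof. exact: op_pow_ip mM0 hG bG _ _ _. Qed.
Let hGt : bounded_operator Gt. Proof. exact: op_pow_bounded bG _. Qed.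
Let hGtn : bounded_operator Gtn. Proof. exact: op_pow_bounded bG _. Qed.

Lemma spectral_geomeanE : spectral_geomean dot t A B = Gt \o A \o Gt.
Proof. by []. Qed.

Lemma spectral_geomean_ip x y :
  ip (spectral_geomean dot t A B x) y = ip x (spectral_geomean dot t A B y).
Proof.
have /op_boundsP[/selfadjoint_ip sA _] := bA.
by rewrite spectral_geomeanE /= sGt sA sGt.
Qed.

Lemma spectral_geomean_linear : linear (spectral_geomean dot t A B).
Proof.
by move=> k x y; rewrite spectral_geomeanE /= (proj1 hGt) (proj1 hA) (proj1 hGt).
Qed.

Let N x := P' (Gt (P' x)).
Let N' x := P (Gtn (P x)).
Let lN : linear N. Proof. by move=> k x y; rewrite /N (proj1 hP') (proj1 hGt) (proj1 hP'). Qed.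
Let lN' : linear N'. Proof. by move=> k x y; rewrite /N' (proj1 hP) (proj1 hGtn) (proj1 hP). Qed.
Let sN x y : ip (N x) y = ip x (N y). Proof. by rewrite /N sP' sGt sP'. Qed.
Let sN' x y : ip (N' x) y = ip x (N' y). Proof. by rewrite /N' sP sGtn sP. Qed.
Let N'N x : N' (N x) = x.
Proof.
rewrite /N' /N PP' /Gtn /Gt (op_powD hdot mM0 hG bG) addNr.
by rewrite (op_pow0 hdot mM0 hG bG) PP'.
Qed.
Let t0 : 0 <= t. Proof. by case/andP: ht. Qed.
Let t1 : t <= 1. Proof. by case/andP: ht. Qed.

Let GtP' x : ip (G (P' x)) (P' x) = ip (Q x) x.
Proof. by rewrite GE /= PP' sP PP'. Qed.

Let N_le x : ip (N x) x <= M * ip x x.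
Proof.
have h : 0 <= (1 - t) * ip (P' x) (P' x) + t * ip (op_pow dot G 1 (P' x)) (P' x) +
    -1 * ip (Gt (P' x)) (P' x).
  apply: (op_pow_ge0 hdot mM0 hG bG) => u /andP[mu _]; have u0 := lt_le_trans mM0 mu.
  have := powR_tangent ht ltr01 u0; rewrite !powR1 (powRr1 (ltW u0)); lra.
rewrite (op_pow1 hdot mM0 hG bG) GtP' -[ip (P' x) (P' x)]sP' P'P' in h.
have /andP[_ h1] := ip_A_bounds x; have /op_boundsP[_ /(_ x)/andP[_ h2]] := bQ.
rewrite /N sP'; have := ip_ge0 hdot x => p0.
have h3 := ler_wpM2l t0 h2; have h4 : (1 - t) * ip (A x) x <= (1 - t) * (M * ip x x).
  by apply: ler_wpM2l; rewrite ?subr_ge0.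
lra.
Qed.

Let N'_bounds x : 0 <= ip (N' x) x <= m^-1 * ip x x.
Proof.
apply/andP; split.
  have := @op_pow_ge0 _ _ _ hdot _ _ _ mM0 hG bG 0 0 1 1 (- t) _ (P x).
  rewrite !mul0r !add0r mul1r /N' sP; apply=> u _.
  by rewrite !mul0r !add0r mul1r powR_ge0.
have h : 0 <= (1 - t) * ip (P x) (P x) + t * ip (op_pow dot G (-1) (P x)) (P x) +
    -1 * ip (Gtn (P x)) (P x).
  apply: (op_pow_ge0 hdot mM0 hG bG) => u /andP[mu _]; have u0 := lt_le_trans mM0 mu.
  by have := powRN_bernoulli ht u0; lra.
have Qinv : Q (op_pow dot Q (- 1) x) = x.
  by rewrite -[LHS](op_pow1 hdot m0 hQ bQ) (op_powD hdot m0 hQ bQ) subrr (op_pow0 hdot m0 hQ bQ).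
have Ginv : op_pow dot G (-1) (P x) = P' (op_pow dot Q (-1) x).
  have {1}-> : P x = G (P' (op_pow dot Q (-1) x)) by rewrite GE /= PP' Qinv.
  rewrite -[G _](op_pow1 hdot mM0 hG bG) (op_powD hdot mM0 hG bG) addNr.
  exact: op_pow0 bG _.
rewrite Ginv sP' P'P -[ip (P x) (P x)]sP PP in h.
have /op_boundsP[_ /(_ x)/andP[_ h1]] := bAi.
have h2 : ip (op_pow dot Q (-1) x) x <= m^-1 * ip x x.
  have bQi : op_bounds dot M^-1 m^-1 (op_pow dot Q (-1)).
    apply: (op_pow_bounds hdot m0 hQ bQ) => u /andP[mu uM].
    have u0 := lt_le_trans m0 mu.
    by rewrite powR_inv1 ?(ltW u0)// !lef_pV2 ?posrE// uM.
  by have /op_boundsP[_ /(_ x)/andP[]] := bQi.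
rewrite /N' sP.
have h3 := ler_wpM2l t0 h2; have h4 : (1 - t) * ip (Ai x) x <= (1 - t) * (m^-1 * ip x x).
  by apply: ler_wpM2l; rewrite ?subr_ge0.
lra.
Qed.

Lemma spectral_geomean_ip_le y : y != 0 ->
  ip (spectral_geomean dot t A B y) y <=
  (M + m) ^+ 2 / (4 * M * m) * (ip (A y) y `^ (1 - t) * ip (B y) y `^ t).
Proof.
move=> y0; pose x := P y; pose v := Gt y.
have P'x : P' x = y by rewrite /x P'P.
have x0 : x != 0 by apply: contra_neq y0 => h; rewrite -P'x h (lin0 (proj1 hP')).
have p0 := ip_gt0 hdot x0.
have NxNx : ip (N x) (N x) = ip (spectral_geomean dot t A B y) y.
  by rewrite /N P'x sP' P'P' spectral_geomeanE /= [RHS]sGt ipC.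
have Nxx : ip (N x) x = ip (Gt y) y by rewrite /N sP' P'x.
have hN z : m * ip z z <= ip (N z) z <= M * ip z z.
  by rewrite N_le andbT; exact: ip_inverse_ge N'N N'_bounds.
have step1 := kantorovich_ineq x m0 mM lN sN hN.
rewrite NxNx Nxx in step1.
have /andP[qA _] := ip_A_bounds y; have /andP[qB _] := ip_B_bounds y.
have yy0 := ip_gt0 hdot y0.
have al0 := lt_le_trans (mulr_gt0 m0 yy0) qA.
have be0 := lt_le_trans (mulr_gt0 m0 yy0) qB.
have yyE : ip y y = ip (A x) x by rewrite -P'x sP' P'P' ipC.
have GyE : ip (G y) y = ip (Q x) x by rewrite -P'x GtP'.
have Gy0 : 0 < ip (G y) y.
  have /op_boundsP[_ /(_ y)/andP[h _]] := bG.
  by apply: lt_le_trans h; exact: mulr_gt0.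
have step2 := op_pow_jensen hdot mM0 hG bG ht Gy0.
have csA : ip y y ^+ 2 <= ip (A y) y * ip x x.
  rewrite yyE; apply: (le_trans (ip_CauchySchwarz hdot _ _)).
  by rewrite -P'P' P'x sP' P'P' ipC.
have csQ : ip (G y) y ^+ 2 <= ip (B y) y * ip x x.
  rewrite GyE; apply: (le_trans (ip_CauchySchwarz hdot _ _)).
  have -> : ip (Q x) (Q x) = ip (W x) x.
    rewrite -sQ /Q (op_powD hdot mm0 hW bW) (_ : 2^-1 + 2^-1 = 1); last by lra.
    by rewrite (op_pow1 hdot mm0 hW bW).
  by rewrite /W /= sP' P'x.
have k0 : 0 <= (M + m) ^+ 2 / (4 * M * m).
  by rewrite divr_ge0 ?sqr_ge0// !mulr_ge0// ltW.
rewrite -(ler_pM2r p0); apply: (le_trans step1); rewrite -[leRHS]mulrA; apply: ler_wpM2l => //.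
have Gt0 : 0 <= ip (Gt y) y.
  rewrite -Nxx; have /andP[h _] := hN x; apply: le_trans h.
  by rewrite mulr_ge0// ltW.
have sq : ip (Gt y) y ^+ 2 <= (ip y y ^+ 2) `^ (1 - t) * (ip (G y) y ^+ 2) `^ t.
  rewrite !powR_expn ?(ltW yy0) ?(ltW Gy0)// -exprMn ler_sqr ?nnegrE//.
  by rewrite mulr_ge0// powR_ge0.
apply: (le_trans sq).
have t1' : 0 <= 1 - t by rewrite subr_ge0.
have e : ip x x = ip x x `^ (1 - t) * ip x x `^ t.
  by rewrite -powRD ?(gt_eqF p0) ?implybT// subrK powRr1// ltW.
rewrite [X in _ <= _ * X]e mulrACA.
rewrite -(powRM _ (ltW al0) (ltW p0)) -(powRM _ (ltW be0) (ltW p0)).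
apply: ler_pM; rewrite ?powR_ge0//; apply: ge0_ler_powR;
  rewrite ?nnegrE ?sqr_ge0 ?(mulr_ge0 (ltW al0) (ltW p0)) ?(mulr_ge0 (ltW be0) (ltW p0))//.
Qed.

End TwoOperators.
End MeanComparison.

Lemma op_le_scale (R : realType) (H : completeNormedModType R[i])
    (dot : {dot H for (@Num.conj R[i])}) (S T : H -> H) :
  linear S -> linear T -> (forall x y, ip dot (S x) y = ip dot x (S y)) ->
  (forall x y, ip dot (T x) y = ip dot x (T y)) ->
  (forall x, x != 0 -> ip dot (S x) x <= ip dot (T x) x) -> op_le dot S T.
Proof.
move=> lS lT sS sT h; apply/psdP; split=> [|x].
  by apply: selfadjointD; [|apply: selfadjointN]; apply: ip_selfadjoint.
rewrite ipBl subr_ge0; have [->|/h//] := eqVneq x 0.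
by rewrite !ip0r.
Qed.

Unset Implicit Arguments.

Theorem proposition3p2 (R : realType) (H : completeNormedModType R[i])
    (dot : {dot H for (@Num.conj R[i])}) (hdot : hilbert_inner dot)
    (A B : H -> H) (m M t : R)
    (hA : bounded_operator A) (hB : bounded_operator B)
    (m_gt0 : 0 < m) (hmAM : op_bounds dot m M A) (hmBM : op_bounds dot m M B)
    (t_ge0 : 0 <= t) (t_le1 : t <= 1) :
  op_le dot (spectral_geomean dot t A B)
            (scale_op (eta_const m M t) (geomean dot t A B)) /\
  op_le dot (scale_op (eta_const m M t) (geomean dot t A B))
            (scale_op (Gamma_const m M t) (geomean dot t A B)).
Proof.
have [[x x0]|triv] := pselect (exists x : H, x != 0); last first.
  have z (x : H) : x = 0 by apply/eqP/negPn/negP => x0; apply: triv; exists x.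
  by split; split=> [x y|x]; rewrite (z (_ x)) ?(z y) ?(z x) ?linear0l ?linear0r.
have mM := op_bounds_itv hdot hmAM x0.
have ht : 0 <= t <= 1 by rewrite t_ge0.
have lg := geomean_linear hdot t hA hB m_gt0 mM hmAM hmBM.
have sg := geomean_ip hdot t hA hB m_gt0 mM hmAM hmBM.
have lsg (c : R) : linear (scale_op c (geomean dot t A B)).
  by move=> k u v; rewrite /scale_op lg scalerDr !scalerA mulrC.
have ssg (c : R) u v : ip dot (scale_op c (geomean dot t A B) u) v =
    ip dot u (scale_op c (geomean dot t A B) v).
  by rewrite ipZl ipZr sg.
have M0 := lt_le_trans m_gt0 mM.
have K0 : 0 < kantorovich (m / M) (M / m) t.
  apply: kantorovich_gt0; rewrite ?divr_gt0//.
  by rewrite ler_pdivrMr// mulrAC ler_pdivlMr// -!expr2 ler_pXn2r// nnegrE ltW.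
have k0 : 0 < (M + m) ^+ 2 / (4 * M * m).
  by rewrite divr_gt0 ?exprn_gt0 ?addr_gt0 ?mulr_gt0.
have bA y : y != 0 -> 0 < ip dot (A y) y `^ (1 - t) * ip dot (B y) y `^ t.
  move=> y0; have p0 := mulr_gt0 m_gt0 (ip_gt0 hdot y0).
  have /op_boundsP[_ /(_ y)/andP[qA _]] := hmAM.
  have /op_boundsP[_ /(_ y)/andP[qB _]] := hmBM.
  by rewrite mulr_gt0// powR_gt0// (lt_le_trans p0).
split; apply: op_le_scale => //.
- exact: (spectral_geomean_linear hdot t hA hB m_gt0 mM hmAM hmBM).
- exact: (spectral_geomean_ip hdot t hA hB m_gt0 mM hmAM hmBM).
- move=> y y0; rewrite ipZl.
  apply: (le_trans (spectral_geomean_ip_le hdot hA hB m_gt0 mM hmAM hmBM ht y0)).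
  have g := geomean_ip_ge hdot hA hB m_gt0 mM hmAM hmBM ht y0.
  have g0 : 0 <= ip dot (geomean dot t A B y) y.
    by apply: le_trans g; rewrite mulr_ge0 ?(ltW K0) ?(ltW (bA y y0)).
  apply: le_trans (ler_wpM2r g0 (kantorovich_div_le_eta m_gt0 mM ht)).
  by rewrite -[leRHS]mulrA ler_pM2l// [leRHS]mulrC ler_pdivlMr// mulrC.
- move=> y y0; rewrite !ipZl; apply: ler_wpM2r (eta_le_Gamma m_gt0 mM ht).
  apply: le_trans (geomean_ip_ge hdot hA hB m_gt0 mM hmAM hmBM ht y0).
  by rewrite mulr_ge0 ?(ltW K0) ?(ltW (bA y y0)).
Qed.
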